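(* Let $p,q\in[1,\infty)$ with $q\neq p$, and let $\mu,\nu\in P_p(\mathbb{R}^d)$ be two probability measures sharing the same copula. For $i=1,\dots,d$, denote by $F_i$ and $G_i$ the distribution functions of the $i$-th one-dimensional margins of $\mu$ and $\nu$, respectively, and set, for $u\in[0,1]$, $$F^{-1}(u):=(F_1^{-1}(u),\dots,F_d^{-1}(u)),\qquad G^{-1}(u):=(G_1^{-1}(u),\dots,G_d^{-1}(u)),$$ where $F_i^{-1},G_i^{-1}$ are the one-dimensional generalized inverses of $F_i,G_i$. Then the following holds: 1. If $1\le q\le p<\infty$, then $$\int_{[0,1]}\|F^{-1}(u)-G^{-1}(u)\|_p^p\,du\le(W_{p,q}(\mu,\nu))^p\le d^{\frac pq-1}\int_{[0,1]}\|F^{-1}(u)-G^{-1}(u)\|_p^p\,du.$$ 2. If $1\le p\le q<\infty$, then $$d^{\frac pq-1}\int_{[0,1]}\|F^{-1}(u)-G^{-1}(u)\|_p^p\,du\le(W_{p,q}(\mu,\nu))^p\le\int_{[0,1]}\|F^{-1}(u)-G^{-1}(u)\|_p^p\,du.$$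
   Context: For $r\in[1,\infty)$, $\|x\|_r=(\sum_{i=1}^d|x_i|^r)^{1/r}$ on $\mathbb{R}^d$. $P_p(\mathbb{R}^d)$ is the set of Borel probability measures $\mu$ on $\mathbb{R}^d$ with finite moment of order $p$, i.e. $\int_{\mathbb{R}^d}\|x\|^p\,\mu(dx)<\infty$ for one (equivalently, any) norm. A coupling of $\mu$ and $\nu$ is a Borel probability measure $\pi$ on $\mathbb{R}^d\times\mathbb{R}^d$ with $\pi(A\times\mathbb{R}^d)=\mu(A)$ and $\pi(\mathbb{R}^d\times A)=\nu(A)$ for all Borel $A\subseteq\mathbb{R}^d$; $\Pi(\mu,\nu)$ denotes the set of all couplings. The Wasserstein distance $W_{p,q}$ is defined by $$(W_{p,q}(\mu,\nu))^p=\inf_{\pi\in\Pi(\mu,\nu)}\int_{\mathbb{R}^d\times\mathbb{R}^d}\|x-y\|_q^p\,\pi(dx,dy).$$ The generalized inverse (quantile function) of a distribution function $F:\mathbb{R}\to[0,1]$ is $F^{-1}(u)=\inf\{x\in\mathbb{R}:F(x)\ge u\}$ for $u\in[0,1]$ (it is finite for $u\in(0,1)$; the values at the endpoints $u=0,1$, which may be infinite, do not affect the integrals). A $d$-dimensional copula is a function $C:[0,1]^d\to[0,1]$ such that: (1) $C(u)=0$ whenever some $u_i=0$; (2) for all $a,b\in[0,1]^d$ with $a_i\le b_i$ for all $i$, $\sum_{i_1=1}^2\cdots\sum_{i_d=1}^2(-1)^{i_1+\cdots+i_d}C(u_{1i_1},\dots,u_{di_d})\ge0$, where $u_{j1}=a_j$,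 $u_{j2}=b_j$; (3) $C(1,\dots,1,u_i,1,\dots,1)=u_i$ for all $i$ and all $u_i\in[0,1]$. The joint distribution function of $\mu$ is $H_\mu(x_1,\dots,x_d)=\mu(\prod_{i=1}^d(-\infty,x_i])$. The measures $\mu$ and $\nu$, with one-dimensional marginal distribution functions $F_1,\dots,F_d$ and $G_1,\dots,G_d$ respectively, share the same copula if there exists a $d$-dimensional copula $C$ such that, for all $x,y\in\mathbb{R}^d$, $H_\mu(x_1,\dots,x_d)=C(F_1(x_1),\dots,F_d(x_d))$ and $H_\nu(y_1,\dots,y_d)=C(G_1(y_1),\dots,G_d(y_d))$. *)

(* Defs.v *)
From HB Require Import structures.
From mathcomp Require Import all_boot all_order all_algebra.
From mathcomp Require Import all_classical all_reals all_analysis.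

Set Implicit Arguments.
Unset Strict Implicit.
Unset Printing Implicit Defensive.

Import Order.TTheory GRing.Theory Num.Theory.
Import numFieldNormedType.Exports.

Local Open Scope classical_set_scope.
Local Open Scope ring_scope.

(* R^d is [d.-tuple R]. Its measurable structure is the product of the Borel
   sigma-algebras of the factors, i.e. the Borel sigma-algebra of R^d. *)

Definition subt (R : realType) (d : nat) (x y : d.-tuple R) : d.-tuple R :=
  [tuple tnth x i - tnth y i | i < d].

Definition lnorm (R : realType) (d : nat) (r : R) (x : d.-tuple R) : R :=
  (\sum_(i < d) `|tnth x i| `^ r) `^ r^-1.

(* Finiteness does not depend on the norm used in the integrand. *)
Definition finite_moment (R : realType) (d : nat) (p : R)
    (mu : probability (d.-tuple R) R) : Prop :=
  (\int[mu]_x (lnorm p x `^ p)%:E < +oo)%E.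

Definition coupling (R : realType) (d : nat)
    (mu nu : probability (d.-tuple R) R) :
    set (probability (d.-tuple R * d.-tuple R)%type R) :=
  [set pi : probability (d.-tuple R * d.-tuple R)%type R |
   forall A : set (d.-tuple R), measurable A ->
     pi (A `*` [set: d.-tuple R]) = mu A /\
     pi ([set: d.-tuple R] `*` A) = nu A].

Definition wasserstein (R : realType) (d : nat) (p q : R)
    (mu nu : probability (d.-tuple R) R) : \bar R :=
  poweR (ereal_inf [set (\int[pi]_z (lnorm q (subt z.1 z.2) `^ p)%:E)%E
                   | pi in coupling mu nu]) p^-1.

Definition coord (R : realType) (d : nat) (i : 'I_d) (x : d.-tuple R) : R :=
  tnth x i.

HB.instance Definition _ (R : realType) (d : nat) (i : 'I_d) :=
  @isMeasurableFun.Build _ _ (d.-tuple R) R (@coord R d i)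
    (measurable_tnth i).

Definition marginal_cdf (R : realType) (d : nat)
    (mu : probability (d.-tuple R) R) (i : 'I_d) (x : R) : R :=
  fine (cdf (@coord R d i : {RV mu >-> R}) x).

Definition joint_cdf (R : realType) (d : nat)
    (mu : probability (d.-tuple R) R) (x : d.-tuple R) : R :=
  fine (mu [set y | forall i, tnth y i <= tnth x i]).

Definition quantile (R : realType) (F : R -> R) (u : R) : \bar R :=
  ereal_inf [set x%:E | x in [set x | u <= F x]].

(* [fine] changes the value only where a coordinate is infinite, which for
   distribution functions and u in [0, 1] can only happen at u = 0 and u = 1. *)
Definition quantile_vec (R : realType) (d : nat)
    (mu : probability (d.-tuple R) R) (u : R) : d.-tuple R :=
  [tuple fine (quantile (marginal_cdf mu i) u) | i < d].

Definition cube (R : realType) (d : nat) : set (d.-tuple R) :=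
  [set u | forall i, 0 <= tnth u i <= 1].

(* Only the restriction of C to the cube is constrained. In the second
   condition [k j] in {0, 1} stands for the index i_j - 1, so that 0 selects
   a_j and 1 selects b_j. *)
Record is_copula (R : realType) (d : nat) (C : d.-tuple R -> R) : Prop := {
  copula_range : forall u, cube u -> 0 <= C u <= 1 ;
  copula_grounded : forall u, cube u -> (exists i, tnth u i = 0) -> C u = 0 ;
  copula_increasing : forall a b, cube a -> cube b ->
    (forall i, tnth a i <= tnth b i) ->
    0 <= \sum_(k : {ffun 'I_d -> 'I_2})
           (-1) ^+ (\sum_(j < d) (k j).+1)%N *
           C [tuple if k j == ord0 then tnth a j else tnth b j | j < d] ;
  copula_margins : forall (i : 'I_d) (t : R), 0 <= t <= 1 ->
    C [tuple if j == i then t else 1 | j < d] = t }.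

Definition share_copula (R : realType) (d : nat)
    (mu nu : probability (d.-tuple R) R) : Prop :=
  exists C : d.-tuple R -> R, is_copula C /\
    forall x y : d.-tuple R,
      joint_cdf mu x = C [tuple marginal_cdf mu i (tnth x i) | i < d] /\
      joint_cdf nu y = C [tuple marginal_cdf nu i (tnth y i) | i < d].

(* Main.v *)
(* The lower bound is one-dimensional. For p > 1, (max 0 z)^p is a mixture of the hinges
   max 0 (z - t), and by Tonelli E[max 0 (X - Y - t)] is the integral over s of
   P(Y + t <= s < X). On ]0, 1[ the events {G^-1 <= s - t} and {F^-1 <= s} are nested,
   so for the quantile functions this probability is the least one allowed by the
   margins; summing over the coordinates bounds the l^p cost of every coupling.

   For the upper bound, a copula C is realized as the distribution function of a random
   vector U on [0, 1[: the unit cube is bisected repeatedly, and the sub-boxes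
   correspond to nested subintervals of [0, 1[ of lengths equal to their C-volumes. The
   pair (F^-1(U), G^-1(U)) is then a coupling of mu and nu which attains the l^p lower
   bound. Comparing the l^p and l^q norms gives the four inequalities. *)
From HB Require Import structures.
Require Import Defs.
From mathcomp Require Import all_boot all_order all_algebra.
From mathcomp Require Import all_classical all_reals all_analysis.
From mathcomp Require Import measurable_realfun.
From mathcomp Require Import ring lra.

Set Implicit Arguments.
Unset Strict Implicit.
Unset Printing Implicit Defensive.

Import Order.TTheory GRing.Theory Num.Theory.
Import numFieldNormedType.Exports.

Local Open Scope classical_set_scope.
Local Open Scope ring_scope.

(** * Comparison of the l^r norms *)

(** The [l^p] cost splits over the coordinates, so a coupling that is optimal in every coordinate at
    once is optimal for it in [R^d]. Each term sees only the law of a single uniform [U_i], so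
    replacing the common [u] of the stated integral by the dependent vector [U] leaves the cost
    unchanged; the dependence within [U] serves to give the pair the laws [mu] and [nu].

    The obstacle in realizing [C] is that a box of the bisection may straddle the point [u] at every
    level. Comparing lower corners with [u] overcounts and comparing upper corners undercounts,
    which gives only [C u <= P(U <= u)] and [P(U < u) <= C u]. The gap lies on the hyperplanes
    [U_i = u_i], and these are null once the margins of [U] are uniform. Uniformity comes from the
    same two bounds at the points [(1, ..., t, ..., 1)], where [C] equals [t].

    The constant [d^(p/q - 1)] comes from the power-mean inequality for [d] terms. *)

Lemma sum_powR_le_powR_sum (R : realType) (d : nat) (a : 'I_d -> R) (t : R) :
  1 <= t -> (forall i, 0 <= a i) ->
  \sum_(i < d) a i `^ t <= (\sum_(i < d) a i) `^ t.
Proof.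
move=> t1 a0; have t0 : 0 < t by exact: lt_le_trans t1.
have S0 : 0 <= \sum_(i < d) a i by exact: sumr_ge0.
(* Both sides become sums of [a i] times a power [t - 1], and each [a i] is at most the whole
   sum. *)
rewrite -(@mulr_powRB1 _ (\sum_(i < d) a i))// mulr_suml.
apply: ler_sum => i _; rewrite -(@mulr_powRB1 _ (a i))//.
apply: ler_wpM2l => //; apply: ge0_ler_powR; rewrite ?nnegrE ?subr_ge0//.
by rewrite (bigD1 i)//= lerDl sumr_ge0.
Qed.

(* Summing Young's inequality [a_i m^(t-1) <= a_i^t/t + (1-1/t) m^t] at the mean [m]. *)
Lemma powR_sum_le_sum_powR (R : realType) (d : nat) (a : 'I_d -> R) (t : R) :
  (0 < d)%N -> 1 <= t -> (forall i, 0 <= a i) ->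
  (\sum_(i < d) a i) `^ t <= d%:R `^ (t - 1) * \sum_(i < d) a i `^ t.
Proof.
move=> d0 t1 a0; have t0 : 0 < t by exact: lt_le_trans t1.
have dR : 0 < d%:R :> R by rewrite ltr0n.
move: t1; rewrite le_eqVlt => /predU1P[<-|t1].
  rewrite subrr powRr0 mul1r powRr1 ?sumr_ge0//.
  by apply: ler_sum => i _; rewrite powRr1.
set S := \sum_(i < d) a i.
have S0 : 0 <= S by exact: sumr_ge0.
pose m := S / d%:R.
have m0 : 0 <= m by rewrite divr_ge0// ltW.
have SE : S = d%:R * m by rewrite /m mulrC divfK// gt_eqF.
(* The conjugate exponent of [t], so that [(m^(t-1))^s = m^t]. *)
pose s := t / (t - 1).
have t10 : 0 < t - 1 by rewrite subr_gt0.
have s0 : 0 < s by rewrite divr_gt0.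
have ts : t^-1 + s^-1 = 1.
  by rewrite /s invf_div; field; rewrite gt_eqF.
have mE : (m `^ (t - 1)) `^ s = m `^ t.
  by rewrite -powRrM /s mulrC divfK// gt_eqF.
have Young i : a i * m `^ (t - 1) <= a i `^ t / t + m `^ t / s.
  by rewrite -mE; apply: conjugate_powR; rewrite ?powR_ge0.
have : \sum_(i < d) a i * m `^ (t - 1) <= \sum_(i < d) (a i `^ t / t + m `^ t / s).
  by apply: ler_sum.
rewrite big_split/= -!mulr_suml -/S sumr_const card_ord {1}SE.
rewrite -(mulrA _ m) mulr_powRB1// -(mulr_natl (_ `^ _)).
have -> : s^-1 = 1 - t^-1 by lra.
set T := \sum_(i < d) _; move=> H.
(* The summed inequality reads [d m^t <= T/t + (1 - 1/t) d m^t]; the last term is absorbed on the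
   left. *)
have H1 : d%:R * m `^ t <= T.
  have : (d%:R * m `^ t) / t <= T / t by lra.
  by rewrite ler_pM2r// invr_gt0.
rewrite SE powRM ?(ltW dR)// -(@mulr_powRB1 _ d%:R) ?(ltW dR)//.
rewrite -mulrA mulrCA. by rewrite ler_wpM2l// powR_ge0.
Qed.

Section lnorm_compare.
Variables (R : realType) (d : nat).
Implicit Types x y : d.-tuple R.

Lemma lnorm_powR (r : R) x : 0 < r -> lnorm r x `^ r = \sum_(i < d) `|tnth x i| `^ r.
Proof.
move=> r0; rewrite /lnorm -powRrM mulVf ?gt_eqF// powRr1// sumr_ge0//.
Qed.

Lemma lnorm_powR_sum (r s : R) x : 0 < r ->
  lnorm r x `^ s = (\sum_(i < d) `|tnth x i| `^ r) `^ (s / r).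
Proof. by move=> r0; rewrite /lnorm -powRrM mulrC. Qed.

Lemma sum_powR_exp (r s : R) x : 0 < r ->
  \sum_(i < d) (`|tnth x i| `^ r) `^ (s / r) = \sum_(i < d) `|tnth x i| `^ s.
Proof.
by move=> r0; apply: eq_bigr => i _; rewrite -powRrM mulrC divfK ?gt_eqF.
Qed.

Lemma lnorm_powR_ge (r s : R) x : 0 < r -> r <= s ->
  lnorm s x `^ s <= lnorm r x `^ s.
Proof.
move=> r0 rs; have s0 : 0 < s by exact: lt_le_trans rs.
have sr1 : 1 <= s / r by rewrite ler_pdivlMr// mul1r.
rewrite [leLHS](lnorm_powR x s0) [leRHS](lnorm_powR_sum s x r0) -(sum_powR_exp s x r0).
exact: (sum_powR_le_powR_sum sr1 (fun i => powR_ge0 `|tnth x i| r)).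
Qed.

(** The power-mean inequality for [a_i = |x_i|^r] with exponent [s / r]; this is where the exponent
    of [d] in the theorem comes from. *)
Lemma lnorm_powR_le (r s : R) x : (0 < d)%N -> 0 < r -> r <= s ->
  lnorm r x `^ s <= d%:R `^ (s / r - 1) * lnorm s x `^ s.
Proof.
move=> d0 r0 rs; have s0 : 0 < s by exact: lt_le_trans rs.
have sr1 : 1 <= s / r by rewrite ler_pdivlMr// mul1r.
rewrite [leLHS](lnorm_powR_sum s x r0) [X in _ <= _ * X](lnorm_powR x s0) -(sum_powR_exp s x r0).
exact: (powR_sum_le_sum_powR d0 sr1 (fun i => powR_ge0 `|tnth x i| r)).
Qed.

Lemma lnorm_le (r s : R) x : 0 < r -> r <= s -> lnorm s x <= lnorm r x.
Proof.
move=> r0 rs; have s0 : 0 < s by exact: lt_le_trans rs.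
have lnE t : (lnorm t x `^ s) `^ s^-1 = lnorm t x.
  by rewrite -powRrM divff ?gt_eqF// powRr1// powR_ge0.
rewrite -[leLHS]lnE -[leRHS]lnE.
have s10 : 0 <= s^-1 by rewrite invr_ge0 ltW.
exact: (ge0_ler_powR s10 (powR_ge0 _ _) (powR_ge0 _ _) (lnorm_powR_ge x r0 rs)).
Qed.

End lnorm_compare.

(** * Quantile functions *)

Section quantile_function.
Context dT (T : measurableType dT) (R : realType) (P : probability T R).
Variable X : {RV P >-> R}.

Let F (x : R) : R := fine (cdf X x).

Let cdfE x : cdf X x = (F x)%:E.
Proof. by rewrite fineK// fin_num_measure. Qed.

Let F_nd x y : x <= y -> F x <= F y.
Proof. by move=> xy; rewrite -lee_fin -!cdfE cdf_nondecreasing. Qed.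

Lemma fine_cdf_ge0 x : 0 <= F x.
Proof. by rewrite fine_ge0// cdf_ge0. Qed.

Lemma fine_cdf_le1 x : F x <= 1.
Proof. by rewrite -lee_fin -cdfE cdf_le1. Qed.

(** The Galois connection between a distribution function and its quantile function. For [u] in []0,
    1[] the limits at infinity make [{u <= F}] nonempty and bounded below, and right-continuity puts
    its infimum in the set. *)
Lemma quantile_le (u x : R) : 0 < u < 1 ->
  (fine (quantile F u) <= x) = (u <= F x).
Proof.
move=> /andP[u0 u1].
pose S := [set y | u <= F y].
have S0 : S !=set0.
  have /fine_cvg/cvgr_ge/(_ _ u1) := cvg_cdfy1 X.
  by move=> /filter_ex[y]; exists y.
have lS : has_lbound S.
  have /fine_cvg/cvgr_lt/(_ _ u0) := cvg_cdfNy0 X.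
  move=> /filter_ex[y Fy]; exists y => z Sz; rewrite leNgt; apply/negP => zy.
  have := le_lt_trans (F_nd (ltW zy)) Fy.
  by rewrite ltNge => /negP; apply.
have -> : quantile F u = (inf S)%:E by rewrite /quantile ereal_inf_EFin.
apply/idP/idP => /= [Sx|]; last by move=> ux; exact: ge_inf.
have cF : F y @[y --> x^'+] --> F x.
  by apply: (@fine_cvg _ _ _ _ (cdf X)); rewrite -cdfE; exact: cdf_right_continuous.
apply: (cvgr_to_ge cF); near=> y.
have xy : x < y by near: y; exact: nbhs_right_gt.
have [z Sz zy] := inf_lt S0 (le_lt_trans Sx xy).
by rewrite (le_trans Sz)// F_nd// ltW.
Unshelve. all: by end_near. Qed.

End quantile_function.

(* The values outside ]0, 1[ form a null set for the uniform law; zeroing them makes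
   the quantile function a total random variable on the uniform space. *)
Definition quantile01 (R : realType) (F : R -> R) (u : R) : R :=
  if 0 < u < 1 then fine (quantile F u) else 0.

Section quantile01.
Context dT (T : measurableType dT) (R : realType) (P : probability T R).
Variable X : {RV P >-> R}.

Let F (x : R) : R := fine (cdf X x).

Lemma quantile01_le (u x : R) : 0 < u < 1 -> (quantile01 F u <= x) = (u <= F x).
Proof. by move=> u01; rewrite /quantile01 u01 quantile_le. Qed.

Lemma measurable_quantile01 : measurable_fun [set: R] (quantile01 F).
Proof.
apply: measurable_fun_if => //=.
  by apply: measurable_and; exact: measurable_fun_ltr.
have -> : [set: R] `&` (fun u => 0 < u < 1) @^-1` [set true] = `]0, 1[%classic.
  by apply/seteqP; split => u /=; rewrite in_itv//= => -[].
apply: (measurability (@RGenOInfty.G R)) => [|/= _ [_] [r] -> <-].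
  exact: RGenOInfty.measurableE.
have -> : `]0, 1[ `&` (fun u => fine (quantile F u)) @^-1` `]r, +oo[ =
          `]0, 1[ `&` `]F r, +oo[%classic.
  apply/seteqP; split => u /=; rewrite !in_itv/= !andbT => -[u01] H; split => //;
    move: H; by rewrite !ltNge quantile_le.
exact: measurableI.
Qed.

End quantile01.

(** * Optimality of the quantile coupling on the line *)

(** The substitution [t = r^(1/(p-1))] turns the weight [(p-1) t^(p-2) dt] into Lebesgue measure,
    which removes its singularity at [0] when [p < 2]. The value [0] for [r < 0] lets the integral
    run over the whole line. *)
Definition powR_hinge (R : realType) (p r z : R) : R :=
  if 0 <= r then Num.max 0 (z - r `^ (p - 1)^-1) else 0.

Lemma powR_hinge_ge0 (R : realType) (p r z : R) : 0 <= powR_hinge p r z.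
Proof. by rewrite /powR_hinge; case: ifP => // _; rewrite le_max lexx. Qed.

Section powR_kernel.
Variable R : realType.
Local Notation mu := (@lebesgue_measure R).

Let powR_continuous (a x : R) : 0 < x -> {for x, continuous (fun r : R => r `^ a)}.
Proof.
move=> x0; apply: differentiable_continuous; apply/derivable1_diffP.
by apply: derivable_powR; rewrite in_itv/= andbT.
Qed.

Let powR_cvg_right0 (a : R) : 0 < a -> (fun r : R => r `^ a) r @[r --> 0^'+] --> (0 : R) `^ a.
Proof. by move=> a0; rewrite [X in _ --> X]powR0 ?gt_eqF//; exact: powR_cvg0. Qed.

Lemma integral_sub_powR (a b z : R) : 0 < a -> 0 < b ->
  (\int[mu]_(r in `[0%R, b]) (z - r `^ a)%:E =
   (z * b - b `^ (a + 1) / (a + 1))%:E)%E.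
Proof.
move=> a0 b0; have a10 : 0 < a + 1 by rewrite addr_gt0.
pose F r := z * r - r `^ (a + 1) / (a + 1).
have dF (r : R) : 0 < r -> is_derive r (1 : R) F (z - r `^ a).
  move=> r0; have dp := is_derive1_powR (a + 1) r0.
  have -> : F = (z \*: id) - ((a + 1)^-1 \*: (fun s : R => s `^ (a + 1))).
    by apply/funext => s; rewrite /F [_ / _]mulrC.
  apply: is_derive_eq; rewrite /GRing.scale/= addrK.
  by field; rewrite gt_eqF.
have cF (r : R) : 0 < r -> {for r, continuous F}.
  move=> r0; apply: differentiable_continuous; apply/derivable1_diffP.
  by have [] := dF r r0.
rewrite (@continuous_FTC2 _ _ F)//.
- by rewrite /F powR0 ?gt_eqF// mulr0 mul0r subr0 -EFinB subr0.
- apply/continuous_within_itvP => //; split.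
  + move=> r; rewrite in_itv/= => /andP[r0 _].
    by apply: cvgB; [exact: cvg_cst|exact: powR_continuous].
  + by apply: cvgB; [exact: cvg_cst|exact: powR_cvg_right0].
  + apply: cvgB; first exact: cvg_cst.
    exact/cvg_at_left_filter/powR_continuous.
- split.
  + by move=> r; rewrite in_itv/= => /andP[r0 _]; have [] := dF r r0.
  + apply: cvgB.
      by apply: cvgMl_tmp; apply: cvg_at_right_filter; exact: cvg_id.
    by apply: cvgMr_tmp; exact: powR_cvg_right0.
  + exact/cvg_at_left_filter/cF.
- move=> r; rewrite in_itv/= => /andP[r0 _].
  by rewrite derive1E; have [_ ->] := dF r r0.
Qed.

(* Writes [z^p / p], up to truncation at [0], as a mixture of the hinges
   [max 0 (z - t)], here with [t = r^(1/(p-1))]. *)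
Lemma integral_powR_hinge (p z : R) : 1 < p ->
  (\int[mu]_r (powR_hinge p r z)%:E =
   (Num.max 0 z `^ p / p)%:E)%E.
Proof.
rewrite /powR_hinge => p1; have p0 : 0 < p by exact: lt_trans p1.
have p10 : 0 < p - 1 by rewrite subr_gt0.
set a := (p - 1)^-1; have a0 : 0 < a by rewrite invr_gt0.
have [z0|z0] := leP z 0.
  rewrite powR0 ?gt_eqF// mul0r.
  rewrite (eq_integral (fun=> 0%E)) ?integral0// => r _.
  case: ifPn => // _; rewrite max_l// subr_le0.
  by rewrite (le_trans z0)// powR_ge0.
(* The value of [r] at which the hinge reaches [0]; on [[0, b]] the maximum is its second
   argument. *)
pose b := z `^ (p - 1); have b0 : 0 < b by rewrite powR_gt0.
have ba : b `^ a = z by rewrite -powRrM divff ?gt_eqF// powRr1// ltW.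
have rb r : 0 <= r -> (r <= b) = (r `^ a <= z).
  move=> r0; rewrite -ba; apply/idP/idP => h.
    by apply: ge0_ler_powR => //; rewrite ?nnegrE// ltW.
  rewrite leNgt; apply/negP => br; move: h; apply/negP; rewrite -ltNge.
  by apply: gt0_ltr_powR; rewrite ?nnegrE// ltW.
transitivity (\int[mu]_(r in `[0%R, b]) (z - r `^ a)%:E)%E.
  rewrite [RHS]integral_mkcond; apply: eq_integral => r _.
  rewrite patchE; case: ifPn => [r0|]; last first.
    rewrite -ltNge => r0; rewrite memNset// /= in_itv/= => /andP[].
    by rewrite leNgt r0.
  have [rbb|br] := leP r b.
    rewrite mem_set ?max_r ?subr_ge0 -?rb//.
    by rewrite /= in_itv/= r0.
  have zr : z - r `^ a <= 0 by rewrite subr_le0 ltW// ltNge -rb// -ltNge.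
  by rewrite memNset ?max_l//= in_itv/= r0 leNgt br.
rewrite integral_sub_powR//; congr EFin.
have -> : b `^ (a + 1) = z * b.
  by rewrite powRD ?ba ?powRr1 ?(ltW b0)// (gt_eqF b0) implybT.
have -> : z * b = z `^ p by rewrite /b mulr_powRB1// ltW.
by rewrite /a; field; rewrite !gt_eqF// addrC subrK.
Qed.

End powR_kernel.

Section hinge_moment.
Context dT (T : measurableType dT) (R : realType) (P : probability T R).
Variables X Y : T -> R.
Hypotheses (mX : measurable_fun setT X) (mY : measurable_fun setT Y).
Local Notation mu := (@lebesgue_measure R).

Let hinge_set (t : R) (z : T * R) : bool := (Y z.1 + t <= z.2) && (z.2 < X z.1).

Let f (t : R) (z : T * R) : \bar R := (if hinge_set t z then 1 else 0)%:E.

Let measurable_f t : measurable_fun setT (f t).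
Proof.
apply/measurable_EFinP; apply: measurable_fun_ifT => //.
apply: measurable_and.
- apply: measurable_fun_ler => //; apply: measurable_funD => //.
  exact: measurableT_comp.
- by apply: measurable_fun_ltr => //; exact: measurableT_comp.
Qed.

Let f_ge0 t z : (0 <= f t z)%E.
Proof. by rewrite lee_fin; case: ifP. Qed.

Let measurable_level (t s : R) : measurable [set w | Y w + t <= s /\ s < X w].
Proof.
rewrite (_ : [set w | _] =
    ((fun w => Y w + t) @^-1` `]-oo, s]) `&` (X @^-1` `]s, +oo[)); last first.
  by apply/seteqP; split => w /=; rewrite !in_itv/= andbT.
apply: measurableI; rewrite -[X in measurable X]setTI; last exact: mX.
by apply: measurable_funD => //.
Qed.

Let section_s (t s : R) : (\int[P]_w f t (w, s) = P [set w | (Y w + t <= s /\ s < X w)%R])%E.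
Proof.
rewrite -[X in _ = P X]setIT -integral_indic//.
apply: eq_integral => w _; rewrite /f indicE; congr EFin.
rewrite /hinge_set/=; case: ifPn => [/andP h|/andP h].
  by rewrite mem_set.
by rewrite memNset.
Qed.

Let section_w (t : R) w : (\int[mu]_s f t (w, s) = (Num.max 0 (X w - Y w - t))%:E)%E.
Proof.
transitivity (mu `[Y w + t, X w[%classic).
  rewrite -[X in _ = mu X]setIT -integral_indic//.
  apply: eq_integral => s _; rewrite /f indicE; congr EFin.
  rewrite /hinge_set/=; case: ifPn => h; first by rewrite mem_set//= in_itv.
  by rewrite memNset//= in_itv/=; exact/negP.
rewrite lebesgue_measure_itv/= lte_fin; case: ltP => h.
  by rewrite -EFinB max_r ?subr_ge0; [congr EFin; ring|lra].
by rewrite max_l//; lra.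
Qed.

(** Both sides integrate the indicator of [Y + t <= s < X]: over [s] first it gives the length of
    [[Y + t, X[], over [w] first the probability of the event. *)
Lemma integral_hinge (t : R) :
  (\int[P]_w (Num.max 0 (X w - Y w - t))%:E =
   \int[mu]_s P [set w | (Y w + t <= s /\ s < X w)%R])%E.
Proof.
have := @fubini_tonelli _ _ _ _ R P mu (f t) (measurable_f t) (f_ge0 t).
under eq_integral do rewrite section_w.
by under [X in _ = X -> _]eq_integral do rewrite section_s.
Qed.

Lemma measurable_hinge_level (t : R) :
  measurable_fun setT (fun s => P [set w | Y w + t <= s /\ s < X w]).
Proof.
have := @measurable_fun_fubini_tonelli_G _ _ _ _ R P (f t) (measurable_f t) (f_ge0 t).
by rewrite /fubini_G; under eq_fun do rewrite section_s.
Qed.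

Let measurable_powR_hinge p :
  measurable_fun setT (fun z : T * R => (powR_hinge p z.2 (X z.1 - Y z.1))%:E).
Proof.
apply/measurable_EFinP; apply: measurable_fun_ifT => //.
  exact: measurable_fun_ler.
apply: measurable_maxr => //; apply: measurable_funB.
  by apply: measurable_funB; exact: measurableT_comp.
by apply: (measurableT_comp (measurable_powR _)).
Qed.

Lemma integral_pos_powR (p : R) : 1 < p ->
  (\int[P]_w (Num.max 0 (X w - Y w) `^ p)%:E =
   p%:E * \int[mu]_r \int[P]_w (powR_hinge p r (X w - Y w))%:E)%E.
Proof.
move=> p1; have p0 : 0 < p by exact: lt_trans p1.
have := @fubini_tonelli _ _ _ _ R P mu _ (measurable_powR_hinge p) (fun z => powR_hinge_ge0 _ _ _).
move=> <-/=; under [in RHS]eq_integral do rewrite integral_powR_hinge//.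
rewrite -ge0_integralZl//=; last 3 first.
- apply/measurable_EFinP; apply: measurable_funM => //.
  apply: (measurableT_comp (measurable_powR _)).
  by apply: measurable_maxr => //; exact: measurable_funB.
- by move=> w _; rewrite lee_fin divr_ge0 ?powR_ge0// ltW.
- by rewrite lee_fin ltW.
by apply: eq_integral => w _; rewrite -EFinM mulrC divfK// gt_eqF.
Qed.

Lemma measurable_integral_powR_hinge (p : R) :
  measurable_fun setT (fun r => \int[P]_w (powR_hinge p r (X w - Y w))%:E)%E.
Proof.
exact: (@measurable_fun_fubini_tonelli_G _ _ _ _ R P _
  (measurable_powR_hinge p) (fun z => powR_hinge_ge0 _ _ _)).
Qed.

End hinge_moment.

(* [(X2, Y2)] will be the comonotone coupling: its quadrants [y <= t, s < x] are the
   intersections of nested events, hence have the least possible probability. *)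
Section quadrant_comparison.
Context d1 (T1 : measurableType d1) d2 (T2 : measurableType d2) (R : realType).
Variables (P1 : probability T1 R) (P2 : probability T2 R).
Variables (X1 Y1 : T1 -> R) (X2 Y2 : T2 -> R).
Hypotheses (mX1 : measurable_fun setT X1) (mY1 : measurable_fun setT Y1).
Hypotheses (mX2 : measurable_fun setT X2) (mY2 : measurable_fun setT Y2).
Hypothesis quadrant_le : forall t s : R,
  (P2 [set w | (Y2 w <= t /\ s < X2 w)%R] <= P1 [set w | (Y1 w <= t /\ s < X1 w)%R])%E.

Lemma integral_hinge_le (t : R) :
  (\int[P2]_w (Num.max 0 (X2 w - Y2 w - t))%:E <=
   \int[P1]_w (Num.max 0 (X1 w - Y1 w - t))%:E)%E.
Proof.
rewrite !integral_hinge//; apply: ge0_le_integral => //.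
- exact: measurable_hinge_level.
- exact: measurable_hinge_level.
- move=> s _; have shift (T : Type) (X Y : T -> R) :
      [set w | Y w + t <= s /\ s < X w] = [set w | Y w <= s - t /\ s < X w].
    by apply/seteqP; split=> w /=; rewrite lerBrDr.
  by rewrite !shift quadrant_le.
Qed.

Lemma integral_pos_powR_le (p : R) : 1 <= p ->
  (\int[P2]_w (Num.max 0 (X2 w - Y2 w) `^ p)%:E <=
   \int[P1]_w (Num.max 0 (X1 w - Y1 w) `^ p)%:E)%E.
Proof.
rewrite le_eqVlt => /predU1P[<-|p1].
  (* At [p = 1] the exponent [1/(p-1)] has no meaning, but the positive part is itself the hinge at
     [t = 0]. *)
  have E z : Num.max 0 z `^ 1 = Num.max 0 (z - 0) :> R.
    by rewrite subr0 powRr1// le_max lexx.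
  under eq_integral do rewrite E.
  by under [leRHS]eq_integral do rewrite E; exact: integral_hinge_le.
have p0 : 0 < p by exact: lt_trans p1.
rewrite (integral_pos_powR P1 mX1 mY1 p1) (integral_pos_powR P2 mX2 mY2 p1).
apply: lee_pmul => //.
- by rewrite lee_fin ltW.
- by apply: integral_ge0 => r _; apply: integral_ge0 => w _; rewrite lee_fin powR_hinge_ge0.
apply: ge0_le_integral => //.
- by move=> r _; apply: integral_ge0 => w _; rewrite lee_fin powR_hinge_ge0.
- exact: measurable_integral_powR_hinge.
- exact: measurable_integral_powR_hinge.
move=> r _; rewrite /powR_hinge; case: (0 <= r); first exact: integral_hinge_le.
by rewrite [leLHS]integral0 [leRHS]integral0.
Qed.

End quadrant_comparison.

(** The endpoints are null, so each use may choose the shape of interval that suits it: []0, 1[] for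
    quantiles, [[0, 1[] for the bisection, []0, 1]] for half-lines. *)
Lemma uniform01E (R : realType) (b0 b1 : bool) (A : set R) : measurable A ->
  uniform_prob (@ltr01 R) A =
  lebesgue_measure (A `&` [set` Interval (BSide b0 0) (BSide b1 1)]).
Proof.
move=> mA.
have mI : measurable_fun setT (fun x : R => (\1_A x)%:E : \bar R).
  by apply/measurable_EFinP; exact: measurable_indic.
rewrite -[in LHS](setIT A) -integral_indic// integral_uniform//.
rewrite subr0 invr1 mul1e.
rewrite (@integral_itv_bndoo _ 0 1 (fun x => (\1_A x)%:E) true false); last first.
  exact: measurable_funTS.
rewrite -(@integral_itv_bndoo _ 0 1 (fun x => (\1_A x)%:E) b0 b1); last first.
  exact: measurable_funTS.
by rewrite integral_indic.
Qed.

Lemma integral_uniform01 (R : realType) (f : R -> \bar R) :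
  measurable_fun setT f -> (forall x, 0 <= f x)%E ->
  (\int[uniform_prob (@ltr01 R)]_x f x = \int[lebesgue_measure]_(x in `]0%R, 1%R[) f x)%E.
Proof.
move=> mf f0; rewrite integral_uniform// subr0 invr1 mul1e.
by rewrite (@integral_itv_bndoo _ 0 1 f true false)//; exact: measurable_funTS.
Qed.

Lemma powR_norm_pos_neg (R : realType) (p z : R) : 0 < p ->
  `|z| `^ p = Num.max 0 z `^ p + Num.max 0 (- z) `^ p.
Proof.
move=> p0; have [z0|z0] := leP 0 z.
  by rewrite ger0_norm// [X in _ + X `^ p]max_l ?oppr_le0// powR0 ?gt_eqF// addr0.
by rewrite ltr0_norm// powR0 ?gt_eqF// add0r max_r// oppr_ge0 ltW.
Qed.

Section comonotone_optimal.
Context dT (T : measurableType dT) (R : realType) (P : probability T R).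
Local Notation U := (uniform_prob (@ltr01 R)).

Let F (X : {RV P >-> R}) (x : R) : R := fine (cdf X x).

(** Up to a null set the event on the left is [F X s < u <= F Y t], of measure
    [max 0 (F Y t - F X s)]. On the right, [{Y <= t}] is covered by [{X <= s}] and the quadrant, so
    the same difference bounds its probability from below. *)
Let comonotone_quadrant_le (X Y : {RV P >-> R}) (t s : R) :
  (U [set u | (quantile01 (F Y) u <= t /\ s < quantile01 (F X) u)%R] <=
   P [set w | (Y w <= t /\ s < X w)%R])%E.
Proof.
set A := [set u | _].
have mA : measurable A.
  rewrite (_ : A = (quantile01 (F Y)) @^-1` `]-oo, t] `&`
                   (quantile01 (F X)) @^-1` `]s, +oo[); last first.
    by apply/seteqP; split => w /=; rewrite !in_itv/= andbT.
  by apply: measurableI; rewrite -[X in measurable X]setTI; exact: measurable_quantile01.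
rewrite (uniform01E false true)//.
have AF : A `&` `]0, 1[ `<=` `]F X s, F Y t]%classic.
  move=> u /= [[uY uX]]; rewrite !in_itv/= => u01.
  by rewrite -(quantile01_le Y)// uY andbT ltNge -(quantile01_le X)// -ltNge.
have mX : measurable (X @^-1` `]-oo, s]) by exact: measurable_funPTI.
have mY : measurable (Y @^-1` `]-oo, t]) by exact: measurable_funPTI.
have cdfE (Z : {RV P >-> R}) r : (F Z r)%:E = P (Z @^-1` `]-oo, r]).
  by rewrite fineK// fin_num_measure.
apply: (@le_trans _ _ (lebesgue_measure `]F X s, F Y t]%classic)).
  by apply: le_measure => //; rewrite inE//; exact: measurableI.
rewrite lebesgue_measure_itv/= lte_fin; case: ifPn => [FXY|_]; last exact: measure_ge0.
rewrite EFinN leeBlDr// !cdfE.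
apply: (@le_trans _ _ (P ((Y @^-1` `]-oo, t] `\` X @^-1` `]-oo, s]) `|` X @^-1` `]-oo, s]))).
  apply: le_measure; rewrite ?inE//.
    by apply: measurableU => //; exact: measurableD.
  by move=> w Yw; have [Xw|Xw] := pselect ((X @^-1` `]-oo, s]) w); [right|left].
apply: (le_trans (measureU2 _ _ _)) => //; first exact: measurableD.
apply: leeD => //; apply: le_measure; rewrite ?inE//.
- exact: measurableD.
- rewrite (_ : [set w | _] = Y @^-1` `]-oo, t] `&` X @^-1` `]s, +oo[).
    by apply: measurableI => //; exact: measurable_funPTI.
  by apply/seteqP; split => w /=; rewrite !in_itv/= andbT.
- by move=> w [] /=; rewrite !in_itv/= => ? /negP; rewrite -ltNge.
Qed.

(** [|z|^p] splits into the powers of the positive and negative parts; the negative part is handled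
    by the quadrant inequality with [X] and [Y] exchanged. *)
Lemma comonotone_optimal (p : R) (X Y : {RV P >-> R}) : 1 <= p ->
  (\int[U]_u (`|quantile01 (F X) u - quantile01 (F Y) u| `^ p)%:E <=
   \int[P]_w (`|X w - Y w| `^ p)%:E)%E.
Proof.
move=> p1; have p0 : 0 < p by exact: lt_le_trans p1.
have mQ (Z : {RV P >-> R}) := measurable_quantile01 Z.
have mpos d' (T' : measurableType d') (V W : T' -> R) :
    measurable_fun setT V -> measurable_fun setT W ->
    measurable_fun setT (fun w => (Num.max 0 (V w - W w) `^ p)%:E).
  move=> mV mW; apply/measurable_EFinP; apply: (measurableT_comp (measurable_powR _)).
  by apply: measurable_maxr => //; exact: measurable_funB.
under eq_integral do rewrite powR_norm_pos_neg// opprB EFinD.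
under [leRHS]eq_integral do rewrite powR_norm_pos_neg// opprB EFinD.
have mQ2 A B := mpos _ _ _ _ (mQ A) (mQ B).
rewrite !ge0_integralD//; try exact: mpos; try exact: mQ2;
  try by move=> *; rewrite lee_fin powR_ge0.
apply: leeD; apply: integral_pos_powR_le; try exact: mQ; try exact: measurable_funPT; move=> // t s.
  exact: (comonotone_quadrant_le X Y t s).
exact: (comonotone_quadrant_le Y X t s).
Qed.

End comonotone_optimal.

(** * Realization of a copula by a random vector *)

Section copula_volume.
Variables (R : realType) (d : nat).
Implicit Types (a b u x : d.-tuple R) (C : d.-tuple R -> R) (i : 'I_d) (t : R).
Implicit Type k : {ffun 'I_d -> 'I_2}.

Definition tupd x i t : d.-tuple R := [tuple if j == i then t else tnth x j | j < d].

Lemma tnth_tupd x i t j : tnth (tupd x i t) j = if j == i then t else tnth x j.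
Proof. by rewrite tnth_mktuple. Qed.

Definition tmin a u : d.-tuple R := [tuple Num.min (tnth a j) (tnth u j) | j < d].

Lemma tnth_tmin a u j : tnth (tmin a u) j = Num.min (tnth a j) (tnth u j).
Proof. by rewrite tnth_mktuple. Qed.

Definition corner a b k : d.-tuple R :=
  [tuple if k j == ord0 then tnth a j else tnth b j | j < d].

Definition csign k : R := (-1) ^+ (\sum_(j < d) (k j).+1)%N.

(** The [C]-volume of the box between [a] and [b], written so that [copula_increasing] is literally
    its nonnegativity. *)
Definition cvol C a b : R := \sum_(k : {ffun 'I_d -> 'I_2}) csign k * C (corner a b k).

Let flip i k : {ffun 'I_d -> 'I_2} := [ffun j => if j == i then rev_ord (k j) else k j].

Let flipK i : involutive (flip i).
Proof.
by move=> k; apply/ffunP => j; rewrite !ffunE; case: eqP => // _; rewrite rev_ordK.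
Qed.

Let rev_ord2 (m : 'I_2) : (rev_ord m == ord0) = (m != ord0).
Proof. by case: m => [[|[|]]]. Qed.

Let csign_flip i k : csign (flip i k) = - csign k.
Proof.
rewrite /csign (bigD1 i)//= [in RHS](bigD1 i)//= ffunE eqxx.
under eq_bigr => j /negbTE ji do rewrite ffunE ji.
rewrite !exprD; case: (k i) => [[|[|]]]//= m.
  by rewrite expr2 expr1 mulrN1 opprK mul1r mulN1r opprK.
by rewrite expr2 expr1 mulrN1 opprK mul1r mulN1r.
Qed.

(** Corners that differ only in coordinate [i] carry opposite signs; pairing them leaves increments
    of [C] in that coordinate, which telescope when the box is cut and vanish when it is flat. *)
Lemma cvolE C a b i : cvol C a b =
  \sum_(k : {ffun 'I_d -> 'I_2} | k i == ord0) csign k * (C (tupd (corner a b k) i (tnth a i)) -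
                                    C (tupd (corner a b k) i (tnth b i))).
Proof.
rewrite /cvol (bigID (fun k : {ffun 'I_d -> 'I_2} => k i == ord0))/=.
rewrite [X in _ + X](reindex_inj (inv_inj (flipK i)))/=.
rewrite [X in _ + X](eq_bigl (fun k : {ffun 'I_d -> 'I_2} => k i == ord0)); last first.
  by move=> k; rewrite ffunE eqxx rev_ord2 negbK.
rewrite -big_split/=; apply: eq_bigr => k /eqP ki0.
rewrite csign_flip mulNr mulrBr; congr (_ * C _ - _ * C _).
  by apply: eq_from_tnth => j; rewrite tnth_tupd !tnth_mktuple;
    have [->|] := eqVneq j i; rewrite ?ki0.
apply: eq_from_tnth => j; rewrite tnth_tupd !tnth_mktuple ffunE.
by have [->|] := eqVneq j i; rewrite ?ki0.
Qed.

Let corner_updl a b i t s k : tupd (corner (tupd a i t) b k) i s = tupd (corner a b k) i s.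
Proof.
by apply: eq_from_tnth => j; rewrite !tnth_tupd; have [//|/negbTE ji] := eqVneq j i;
  rewrite !tnth_mktuple ji.
Qed.

Let corner_updr a b i t s k : tupd (corner a (tupd b i t) k) i s = tupd (corner a b k) i s.
Proof.
by apply: eq_from_tnth => j; rewrite !tnth_tupd; have [//|/negbTE ji] := eqVneq j i;
  rewrite !tnth_mktuple ji.
Qed.

Lemma cvol_split C a b i t :
  cvol C a b = cvol C a (tupd b i t) + cvol C (tupd a i t) b.
Proof.
rewrite !(cvolE C _ _ i) -big_split/=; apply: eq_bigr => k _.
by rewrite !tnth_tupd eqxx !corner_updl !corner_updr -mulrDr addrA subrK.
Qed.

Lemma cvol_degenerate C a b i : tnth a i = tnth b i -> cvol C a b = 0.
Proof. by move=> ab; rewrite (cvolE C _ _ i) big1// => k _; rewrite ab subrr mulr0. Qed.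

Section is_copula.
Variable C : d.-tuple R -> R.
Hypothesis copC : is_copula C.

Lemma cvol_ge0 a b : cube a -> cube b -> (forall i, tnth a i <= tnth b i) ->
  0 <= cvol C a b.
Proof. exact: copula_increasing. Qed.

(** Every corner except [u] has a zero coordinate, where [C] vanishes; the sign at [u] is
    [(-1)^(2d)]. *)
Lemma cvol0 u : cube u -> cvol C [tuple 0 | _ < d] u = C u.
Proof.
move=> cu; rewrite /cvol (bigD1 [ffun=> rev_ord ord0])//= big1 ?addr0.
  rewrite /csign; under eq_bigr do rewrite ffunE/=.
  rewrite sum_nat_const mulnC exprM sqrrN !expr1n mul1r; congr C.
  by apply: eq_from_tnth => j; rewrite tnth_mktuple ffunE.
move=> k k1.
have [i ki] : exists i, k i = ord0.
  apply: contrapT => /forallNP kn; move/eqP: k1; apply; apply/ffunP => j.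
  rewrite ffunE; apply/eqP; rewrite -[_ == _]negbK -(inj_eq rev_ord_inj) rev_ordK.
  by rewrite rev_ord2 negbK; apply/eqP; exact: kn.
rewrite (copula_grounded copC) ?mulr0//.
  move=> j; rewrite tnth_mktuple tnth_mktuple; case: ifP => _; last exact: cu.
  by rewrite lexx ler01.
by exists i; rewrite tnth_mktuple ki tnth_mktuple.
Qed.

(** The left side is the volume of the box cut by the orthant below [u]. If some [u_i <= a_i] the
    cut box is flat; otherwise the upper corner is lowered one coordinate at a time, each cut
    removing a box of nonnegative volume. *)
Lemma cvol_tmin_le a b u : cube a -> cube b -> cube u ->
  (forall i, tnth a i <= tnth b i) -> cvol C (tmin a u) (tmin b u) <= cvol C a b.
Proof.
move=> ca cb cu ab.
have [[i ui]|/forallNP au] := pselect (exists i, tnth u i <= tnth a i).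
  rewrite (@cvol_degenerate _ _ _ i) ?cvol_ge0// !tnth_tmin !min_r//.
  exact: le_trans ui _.
have {}au i : tnth a i <= tnth u i by rewrite leNgt; apply/negP => /ltW; exact: au.
have -> : tmin a u = a by apply: eq_from_tnth => i; rewrite tnth_tmin min_l.
pose B (l : seq 'I_d) : d.-tuple R :=
  [tuple if j \in l then Num.min (tnth b j) (tnth u j) else tnth b j | j < d].
have -> : tmin b u = B (enum 'I_d).
  by apply: eq_from_tnth => i; rewrite tnth_tmin tnth_mktuple mem_enum.
elim: (enum 'I_d) => [|i l IH].
  by rewrite (_ : B [::] = b)//; apply: eq_from_tnth => i; rewrite tnth_mktuple.
apply: (le_trans _ IH); pose m := Num.min (tnth b i) (tnth u i).
have -> : B (i :: l) = tupd (B l) i m.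
  apply: eq_from_tnth => j; rewrite tnth_tupd !tnth_mktuple in_cons.
  by case: eqP => [->|].
rewrite [leRHS](cvol_split C _ _ i m) lerDl.
have am : tnth a i <= m by rewrite /m le_min ab au.
have mb : m <= tnth b i by rewrite /m ge_min lexx.
have aB j : tnth a j <= tnth (B l) j.
  by rewrite tnth_mktuple; case: ifP => // _; rewrite le_min ab au.
have Bb j : tnth (B l) j <= tnth b j.
  by rewrite tnth_mktuple; case: ifP => // _; rewrite ge_min lexx.
apply: cvol_ge0 => j; rewrite ?tnth_tupd.
- case: eqP => [_|_]; last exact: ca.
  have /andP[a0 _] := ca i; have /andP[_ b1] := cb i.
  by rewrite (le_trans a0)// (le_trans mb).
- have /andP[a0 _] := ca j; have /andP[_ b1] := cb j.
  by rewrite (le_trans a0)// (le_trans (Bb j)).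
- case: eqP => [->|_] //; rewrite tnth_mktuple; case: ifP => // _.
Qed.

End is_copula.
End copula_volume.

Lemma lebesgue_measure_shift (R : realType) (v : R) (A : set R) : measurable A ->
  lebesgue_measure ((fun x => x - v) @^-1` A) = lebesgue_measure A.
Proof.
move=> mA; transitivity (pushforward lebesgue_measure
    ((fun x : R => x - v) : _ -> measurableTypeR R) A) => //.
apply/esym/lebesgue_measure_unique => //=.
  exact: measurable_funB.
move=> _ _ [[a b]] _ <-.
rewrite /pushforward (_ : _ @^-1` _ = `]a + v, b + v]%classic); last first.
  by apply/seteqP; split => x /=; rewrite !in_itv/= ltrBrDr lerBlDr.
rewrite !lebesgue_measure_itv/= !lte_fin ltrD2r.
by case: ifP => // _; rewrite -!EFinB; congr EFin; ring.
Qed.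

(* Bisecting [0, 1]^d one coordinate at a time, every box being assigned a subinterval
   of [0, 1[ whose length is its C-volume: the point [x] descends to the boxes
   whose intervals contain it. A state holds a box and the offset of [x] in its interval. *)
Section copula_tree.
Variables (R : realType) (d : nat) (C : d.-tuple R -> R).
Hypothesis copC : is_copula C.
Local Notation T := (d.-tuple R).
Local Notation mu := (@lebesgue_measure R).

Definition tree_step (s : T * T * R) (i : 'I_d) : T * T * R :=
  let a := s.1.1 in let b := s.1.2 in let m := (tnth a i + tnth b i) / 2 in
  let v := cvol C a (tupd b i m) in
  if s.2 < v then (a, tupd b i m, s.2) else (tupd a i m, b, s.2 - v).

Definition tree (l : seq 'I_d) (s : T * T * R) := foldl tree_step s l.

Arguments tree : simpl never.

Definition box (ab : T * T) :=
  [/\ cube ab.1, cube ab.2 & forall i, tnth ab.1 i <= tnth ab.2 i].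

Definition midl (ab : T * T) i : T * T :=
  (ab.1, tupd ab.2 i ((tnth ab.1 i + tnth ab.2 i) / 2)).

Definition midr (ab : T * T) i : T * T :=
  (tupd ab.1 i ((tnth ab.1 i + tnth ab.2 i) / 2), ab.2).

Definition subbox (l : seq 'I_d) (ab ab' : T * T) := forall i,
  [/\ tnth ab.1 i <= tnth ab'.1 i, tnth ab'.2 i <= tnth ab.2 i &
  tnth ab'.2 i - tnth ab'.1 i = (tnth ab.2 i - tnth ab.1 i) * 2^-1 ^+ count_mem i l].

Lemma midl_subbox ab i : box ab -> box (midl ab i) /\ subbox [:: i] ab (midl ab i).
Proof.
case=> ca cb ab_le; split; first split => //= j.
- rewrite tnth_tupd; case: eqP => _; last exact: cb.
  have := ca i; have := cb i; have := ab_le i => h /andP[h1 h2] /andP[h3 h4].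
  by apply/andP; split; lra.
- by rewrite tnth_tupd; case: eqP => [->|//]; have := ab_le i => h; lra.
- move=> j; rewrite /midl/= tnth_tupd addn0 (eq_sym i j).
  case: eqP => [->|_]; rewrite ?expr1 ?expr0; have := ab_le i => h; split; lra.
Qed.

Lemma midr_subbox ab i : box ab -> box (midr ab i) /\ subbox [:: i] ab (midr ab i).
Proof.
case=> ca cb ab_le; split; first split => //= j.
- rewrite tnth_tupd; case: eqP => _; last exact: ca.
  have := ca i; have := cb i; have := ab_le i => h /andP[h1 h2] /andP[h3 h4].
  by apply/andP; split; lra.
- by rewrite tnth_tupd; case: eqP => [->|//]; have := ab_le i => h; lra.
- move=> j; rewrite /midr/= tnth_tupd addn0 (eq_sym i j).
  case: eqP => [->|_]; rewrite ?expr1 ?expr0; have := ab_le i => h; split; lra.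
Qed.

Lemma tree_stepE ab x i : tree_step (ab, x) i =
  if x < cvol C (midl ab i).1 (midl ab i).2 then (midl ab i, x)
  else (midr ab i, x - cvol C (midl ab i).1 (midl ab i).2).
Proof. by []. Qed.

Lemma tree_cons i l ab x : tree (i :: l) (ab, x) =
  if x < cvol C (midl ab i).1 (midl ab i).2 then tree l (midl ab i, x)
  else tree l (midr ab i, x - cvol C (midl ab i).1 (midl ab i).2).
Proof. by rewrite /tree/= tree_stepE; case: ifP. Qed.

Lemma tree_subbox l ab x : box ab ->
  box (tree l (ab, x)).1 /\ subbox l ab (tree l (ab, x)).1.
Proof.
elim: l ab x => [|i l IH] ab x bab.
  by split => //= j; split => //; rewrite expr0 mulr1.
have trans ab' y : box ab' /\ subbox [:: i] ab ab' ->
    box (tree l (ab', y)).1 /\ subbox (i :: l) ab (tree l (ab', y)).1.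
  move=> [bab' sab']; have [b2 s2] := IH ab' y bab'; split => // j.
  have [h1 h2 h3] := sab' j; have [h4 h5 h6] := s2 j; split.
  - exact: le_trans h4.
  - exact: le_trans h2.
  - by rewrite h6 h3 -mulrA -exprD/= addn0.
by rewrite tree_cons; case: ifP => _; apply: trans; [exact: midl_subbox|exact: midr_subbox].
Qed.

(** The final box takes finitely many values and the offset is only compared with constants, so [f]
    can be arbitrary. *)
Lemma measurable_tree l ab (f : T * T -> R) :
  measurable_fun setT (fun x => f (tree l (ab, x)).1).
Proof.
elim: l ab => [|i l IH] ab; first exact: (@measurable_cst _ _ _ _ _ (f ab)).
under eq_fun do rewrite tree_cons.
rewrite (_ : (fun x => _) = fun x => if x < cvol C (midl ab i).1 (midl ab i).2
    then f (tree l (midl ab i, x)).1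
    else f (tree l (midr ab i, x - cvol C (midl ab i).1 (midl ab i).2)).1); last first.
  by apply/funext => x; case: ifP.
apply: measurable_fun_ifT => //; first exact: measurable_fun_ltr.
apply: (measurableT_comp (IH (midr ab i))); exact: measurable_funB.
Qed.

(** [x] is an offset, so the interval of [ab] always starts at [0]; this is why the right half-box
    appears translated by the volume of the left one in [leaves_cons]. *)
Definition leaves (phi : pred (T * T)) l (ab : T * T) : set R :=
  [set x | 0 <= x < cvol C ab.1 ab.2 /\ phi (tree l (ab, x)).1].

Lemma cvol_mid ab i : cvol C ab.1 ab.2 =
  cvol C (midl ab i).1 (midl ab i).2 + cvol C (midr ab i).1 (midr ab i).2.
Proof. exact: cvol_split. Qed.

Let leaves_cons phi i l ab : box ab ->
  leaves phi (i :: l) ab = leaves phi l (midl ab i) `|`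
    (fun x => x - cvol C (midl ab i).1 (midl ab i).2) @^-1` leaves phi l (midr ab i).
Proof.
move=> bab; set v := cvol C _ (midl ab i).2.
have [[c1 c2 c12] _] := midl_subbox i bab.
have [[c3 c4 c34] _] := midr_subbox i bab.
have v0 : 0 <= v by exact: cvol_ge0.
have w0 : 0 <= cvol C (midr ab i).1 (midr ab i).2 by exact: cvol_ge0.
apply/seteqP; split => x; rewrite /leaves /= tree_cons -/v (cvol_mid ab i) -/v.
- move=> [/andP[x0 xv]]; case: ltP => xv' phx; [left|right]; split => //.
    by rewrite x0.
  by rewrite subr_ge0 xv' ltrBlDl.
- case=> [[/andP[x0 xv] phx]|[/andP[x0 xv] phx]].
    by rewrite xv; split => //; rewrite x0/= (lt_le_trans xv)// lerDl.
  rewrite subr_ge0 in x0; rewrite [x < v]ltNge x0; split => //.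
  by rewrite (le_trans v0 x0)/= -ltrBlDl.
Qed.

Lemma measurable_leaves phi l ab : box ab -> measurable (leaves phi l ab).
Proof.
elim: l ab => [|i l IH] ab bab.
  rewrite /leaves /tree/=; have [pab|pab] := boolP (phi ab).
    rewrite (_ : [set x | _] = `[0, cvol C ab.1 ab.2[%classic)//.
    by apply/seteqP; split => x /=; rewrite in_itv/=; [case|split].
  by rewrite (_ : [set x | _] = set0)//; apply/seteqP; split => x //= -[_].
rewrite leaves_cons//; apply: measurableU; first by apply: IH; exact: (midl_subbox _ bab).1.
rewrite -[X in measurable X]setTI; apply: measurable_funB => //.
by apply: IH; exact: (midr_subbox _ bab).1.
Qed.

Lemma measure_leaves_nil phi ab : box ab ->
  mu (leaves phi [::] ab) = (if phi ab then cvol C ab.1 ab.2 else 0)%:E.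
Proof.
case=> c1 c2 c12; rewrite /leaves /tree/=; case: ifPn => pab.
  rewrite (_ : [set x | _] = `[0, cvol C ab.1 ab.2[%classic).
    rewrite lebesgue_measure_itv/= lte_fin -EFinB subr0.
    by have := cvol_ge0 copC c1 c2 c12; rewrite le_eqVlt => /predU1P[<-|->]; rewrite ?ltxx.
  by apply/seteqP; split => x /=; rewrite in_itv/=; [case|split].
by rewrite (_ : [set x | _] = set0) ?measure0//; apply/seteqP; split => x //= -[_].
Qed.

Lemma measure_leaves_cons phi i l ab : box ab ->
  mu (leaves phi (i :: l) ab) =
  (mu (leaves phi l (midl ab i)) + mu (leaves phi l (midr ab i)))%E.
Proof.
move=> bab; have [bl _] := midl_subbox i bab; have [br _] := midr_subbox i bab.
rewrite leaves_cons// measureU//.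
- by congr (_ + _)%E; apply: lebesgue_measure_shift; exact: measurable_leaves.
- exact: measurable_leaves.
- rewrite -[X in measurable X]setTI; apply: measurable_funB => //.
  exact: measurable_leaves.
- apply/seteqP; split => x //= -[[/andP[_ xv] _] [/andP[+ _] _]].
  by rewrite subr_ge0 leNgt xv.
Qed.

Section truncated_volume.
Variable u : T.
Hypothesis cu : cube u.

Let tvol (ab : T * T) := cvol C (tmin ab.1 u) (tmin ab.2 u).

Let tmin_tupd (a : T) i m : tmin (tupd a i m) u = tupd (tmin a u) i (Num.min m (tnth u i)).
Proof.
apply: eq_from_tnth => j; rewrite tnth_tmin !tnth_tupd tnth_tmin.
by case: eqP => [->|].
Qed.

Let tvol_mid ab i : tvol ab = tvol (midl ab i) + tvol (midr ab i).
Proof. by rewrite /tvol/= !tmin_tupd; exact: cvol_split. Qed.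

Let cube_tmin a : cube a -> cube (tmin a u).
Proof.
move=> ca i; rewrite tnth_tmin; have /andP[? ?] := ca i; have /andP[? ?] := cu i.
by rewrite le_min ge_min; apply/andP; split; [apply/andP|apply/orP; left].
Qed.

Let tvol_ge0 ab : box ab -> 0 <= tvol ab.
Proof.
case=> ca cb ab_le; apply: (cvol_ge0 copC); try exact: cube_tmin.
by move=> i; rewrite !tnth_tmin le_min !ge_min ab_le lexx orbT.
Qed.

(** Both sides are additive under bisection, so only leaves have to be compared: a counted leaf lies
    below [u], and cutting it at [u] changes nothing. *)
Lemma measure_leaves_le (phi : pred (T * T)) l ab : box ab ->
  (forall ab', box ab' -> phi ab' -> forall i, tnth ab'.2 i <= tnth u i) ->
  (mu (leaves phi l ab) <= (tvol ab)%:E)%E.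
Proof.
move=> + phiu; elim: l ab => [|i l IH] ab bab.
  rewrite measure_leaves_nil// lee_fin; case: ifPn => [pab|_]; last exact: tvol_ge0.
  have [ca cb ab_le] := bab; have bu := phiu _ bab pab.
  rewrite le_eqVlt; apply/orP; left; apply/eqP; congr (cvol C _ _);
    apply: eq_from_tnth => i; rewrite tnth_tmin min_l//.
  exact: le_trans (bu i).
rewrite measure_leaves_cons// (tvol_mid ab i) EFinD.
by apply: leeD; apply: IH; [exact: (midl_subbox _ bab).1|exact: (midr_subbox _ bab).1].
Qed.

(** At a counted leaf the cut at [u] can only lower the volume; an uncounted leaf has a lower corner
    exceeding [u] in some coordinate, so its cut box is flat. *)
Lemma measure_leaves_ge (phi : pred (T * T)) l ab : box ab ->
  (forall ab', box ab' -> (forall i, tnth ab'.1 i <= tnth u i) -> phi ab') ->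
  ((tvol ab)%:E <= mu (leaves phi l ab))%E.
Proof.
move=> + phiu; elim: l ab => [|i l IH] ab bab.
  rewrite measure_leaves_nil// lee_fin; have [ca cb ab_le] := bab.
  case: ifPn => [_|pab]; first exact: cvol_tmin_le.
  have [i ui] : exists i, tnth u i < tnth ab.1 i.
    apply: contrapT => /forallNP un; move/negP : pab; apply; apply: phiu => // i.
    by rewrite leNgt; apply/negP.
  rewrite /tvol (@cvol_degenerate _ _ _ _ _ i)// !tnth_tmin !min_r// ltW//.
  exact: lt_le_trans (ab_le i).
rewrite measure_leaves_cons// (tvol_mid ab i) EFinD.
by apply: leeD; apply: IH; [exact: (midl_subbox _ bab).1|exact: (midr_subbox _ bab).1].
Qed.

End truncated_volume.

End copula_tree.

(** * Probability measures determined by half-lines and by orthants *)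

Section probability_unique.
Variable R : realType.

(* [R] and [measurableTypeR R] have the same measurable sets but different displays. *)
Lemma probability_real_unique (m1 : probability R R) (m2 : probability (measurableTypeR R) R) :
  (forall t, m1 `]-oo, t]%classic = m2 `]-oo, t]%classic) ->
  forall A, measurable A -> m1 A = m2 A.
Proof.
move=> m12 A mA.
have mid : @measurable_fun _ _ (measurableTypeR R) R setT idfun.
  by move=> _ Y mY; rewrite setTI.
pose X := @mfun_Sub _ _ (measurableTypeR R) R _ (mem_set mid).
apply: (@measure_unique _ R R (@RGenOInfty.G R)
  (fun n => `](- n%:R)%R, +oo[%classic) _ _ _ _ m1 (distribution m2 X)) => //.
- exact: RGenOInfty.measurableE.
- move=> _ _ [x ->] [y ->]; exists (Num.max x y).
  apply/seteqP; split => z /=; rewrite !in_itv/= !andbT gt_max.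
    by case=> -> ->.
  by move=> /andP[].
- by move=> n; exists (- n%:R).
- rewrite -subTset => x _; exists (Num.bound `|x|) => //=.
  rewrite in_itv/= andbT ltrNl (le_lt_trans _ (archi_boundP (normr_ge0 x)))//.
  by rewrite -normrN ler_norm.
- move=> _ [x ->]; rewrite -setCitvl.
  have mx : measurable `]-oo, x]%classic by exact: measurable_itv.
  apply: (eq_trans (probability_setC m1 mx)); rewrite m12.
  exact/esym/(probability_setC (distribution m2 X) mx).
- by move=> n; rewrite (le_lt_trans (probability_le1 _ _))// ltry.
Qed.

Definition orthant (d : nat) (u : d.-tuple R) : set (d.-tuple R) :=
  [set y | forall i, tnth y i <= tnth u i].

Lemma measurable_orthant (d : nat) (u : d.-tuple R) : measurable (orthant u).
Proof.
have -> : orthant u = \big[setI/setT]_(i < d) ((@tnth d R ^~ i) @^-1` `]-oo, tnth u i]).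
  apply/seteqP; split => y /=.
    by move=> yu; rewrite -bigcap_seq => i _ /=; rewrite in_itv/= yu.
  rewrite -bigcap_seq => yu i.
  by have := yu i (mem_index_enum i); rewrite /= in_itv.
apply: bigsetI_measurable => i _.
by rewrite -[X in measurable X]setTI; exact: measurable_tnth.
Qed.

Let tuple_le_nat (d : nat) (y : d.-tuple R) : exists n : nat, forall j, tnth y j <= n%:R.
Proof.
exists (\max_(j < d) Num.bound `|tnth y j|)%N => j.
rewrite (le_trans (ler_norm _))// (le_trans (ltW (archi_boundP (normr_ge0 _))))//.
by rewrite ler_nat (leq_bigmax j).
Qed.

Lemma probability_tuple_unique (d : nat) (m1 m2 : probability (d.-tuple R) R) :
  (forall u, m1 (orthant u) = m2 (orthant u)) ->
  forall A, measurable A -> m1 A = m2 A.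
Proof.
move=> m12 A mA; pose G := [set orthant u | u in [set: d.-tuple R]].
pose g n : set (d.-tuple R) := orthant [tuple n%:R | _ < d].
(* Orthants generate the product sigma-algebra: [{y_i > t}] is the complement of a countable union
   of orthants, with bound [t] in coordinate [i] and [n] in the others. *)
have mG : measurable_fun [set: g_sigma_algebraType G]
    (fun y : g_sigma_algebraType G => y : d.-tuple R).
  apply/measurable_fun_tnthP => i.
  apply: (measurability (@RGenOInfty.G R)) => [|/= _ [_] [t] -> <-].
    exact: RGenOInfty.measurableE.
  rewrite setTI (_ : _ @^-1` _ = ~` \bigcup_n orthant
      [tuple if j == i then t else n%:R | j < d]).
    apply: measurableC; apply: bigcup_measurable => n _.
    by apply: sub_sigma_algebra; exists [tuple if j == i then t else n%:R | j < d].
  apply/seteqP; split => y /=; rewrite in_itv/= andbT.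
    move=> ty [n _ /(_ i)]; rewrite tnth_mktuple eqxx => yt.
    by move: ty; rewrite ltNge yt.
  move=> yn; rewrite ltNge; apply/negP => yt; apply: yn.
  have [n yn'] := tuple_le_nat y; exists n => //= j.
  by rewrite tnth_mktuple; case: eqP => [->|].
have GA : <<s G>> A.
  by have := mG measurableT A mA; rewrite setTI.
refine (@g_sigma_algebra_measure_unique _ _ _ G _ g _ _ m1 m2 _ _ _ A GA).
- by move=> _ [u _ <-]; exact: measurable_orthant.
- by move=> n; exists [tuple n%:R | _ < d].
- rewrite -subTset => y _; have [n yn] := tuple_le_nat y.
  by exists n => // j; rewrite tnth_mktuple.
- move=> _ _ [u _ <-] [v _ <-]; exists [tuple Num.min (tnth u j) (tnth v j) | j < d] => //.
  apply/seteqP; split => y /= => [yuv|[yu yv] i].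
    by split=> i; have := yuv i; rewrite tnth_mktuple le_min => /andP[].
  by rewrite tnth_mktuple le_min yu yv.
- by move=> _ [u _ <-]; exact: m12.
- by move=> n; rewrite (le_lt_trans (probability_le1 _ _)) ?ltry//; exact: measurable_orthant.
Qed.

End probability_unique.

(** * A random vector with distribution function [C] *)

Section copula_vector.
Variables (R : realType) (d : nat) (C : d.-tuple R -> R).
Hypotheses (d0 : (0 < d)%N) (copC : is_copula C).
Local Notation T := (d.-tuple R).
Local Notation mu := (@lebesgue_measure R).
Local Notation P := (uniform_prob (@ltr01 R)).

Let ab0 : T * T := ([tuple 0 | _ < d], [tuple 1 | _ < d]).

(** One round bisects every coordinate once. Rounds are appended on the right, so the box of [x] at
    level [n.+1] refines its box at level [n]. *)
Let level n : seq 'I_d := iter n (fun l => l ++ enum 'I_d) [::].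

Let lo n x : T := (tree C (level n) (ab0, x)).1.1.
Let hi n x : T := (tree C (level n) (ab0, x)).1.2.

Let box0 : box ab0.
Proof.
by split=> [i|i|i] /=; rewrite !tnth_mktuple ?lexx ?ler01.
Qed.

Let count_level n i : count_mem i (level n) = n.
Proof.
elim: n => //= n IH; rewrite count_cat IH count_uniq_mem ?enum_uniq//.
by rewrite mem_enum addn1.
Qed.

Let level_next n x : subbox (enum 'I_d) (lo n x, hi n x) (lo n.+1 x, hi n.+1 x).
Proof.
have [bn _] := tree_subbox C (level n) x box0.
have [_] := tree_subbox C (enum 'I_d) (tree C (level n) (ab0, x)).2 bn.
rewrite -surjective_pairing.
have -> : tree C (enum 'I_d) (tree C (level n) (ab0, x)) = tree C (level n.+1) (ab0, x).
  by rewrite /tree /= foldl_cat.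
by rewrite /lo /hi -!surjective_pairing.
Qed.

Let lo_nd x i : nondecreasing_seq (fun n => tnth (lo n x) i).
Proof. by apply/nondecreasing_seqP => n; have [] := level_next n x i. Qed.

Let hi_ni x i : nonincreasing_seq (fun n => tnth (hi n x) i).
Proof. by apply/nonincreasing_seqP => n; have [] := level_next n x i. Qed.

Let box_level n x : box (lo n x, hi n x).
Proof. by have [] := tree_subbox C (level n) x box0; rewrite /lo/hi -surjective_pairing. Qed.

Let width n x i : tnth (hi n x) i = tnth (lo n x) i + 2^-1 ^+ n.
Proof.
have [_ /(_ i)[_ _]] := tree_subbox C (level n) x box0.
by rewrite count_level !tnth_mktuple subr0 mul1r => <-; rewrite addrC subrK.
Qed.

(** The common limit of the corners of the nested boxes of [x]. As a supremum of lower corners it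
    lies below [u] exactly when all of them do. *)
Definition copula_vector x : T := [tuple sup (range (fun n => tnth (lo n x) i)) | i < d].

Let lo_bnd x i : has_ubound (range (fun n => tnth (lo n x) i)).
Proof.
exists 1 => _ [n _ <-]; have [c1 _ _] := box_level n x.
by have /andP[] := c1 i.
Qed.

Let lo_le n x i : tnth (lo n x) i <= tnth (copula_vector x) i.
Proof. by rewrite tnth_mktuple; apply: ub_le_sup; [exact: lo_bnd|exists n]. Qed.

Let vec_le x i c : (forall n, tnth (lo n x) i <= c) -> tnth (copula_vector x) i <= c.
Proof.
move=> h; rewrite tnth_mktuple; apply: ge_sup; first by exists (tnth (lo 0%N x) i), 0%N.
by move=> _ [n _ <-].
Qed.

Lemma copula_vector_cube x : cube (copula_vector x).
Proof.
move=> i; apply/andP; split.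
  by have [c1 _ _] := box_level 0 x; have /andP[? _] := c1 i; exact: le_trans (lo_le 0 x i).
by apply: vec_le => n; have [c1 _ _] := box_level n x; have /andP[] := c1 i.
Qed.

Lemma measurable_copula_vector : measurable_fun setT copula_vector.
Proof.
apply/measurable_fun_tnthP => i.
apply: (@measurable_fun_cvg _ _ _ _ (fun n x => tnth (lo n x) i)).
  move=> n; exact: (@measurable_tree _ _ C (level n) ab0 (fun ab => tnth ab.1 i)).
move=> x _ /=; rewrite tnth_mktuple.
by apply: nondecreasing_cvgn; [exact: lo_nd|exact: lo_bnd].
Qed.

Let cube1 : cube ab0.2.
Proof. by case: box0. Qed.

Let cvol1 : cvol C ab0.1 ab0.2 = 1.
Proof.
(* The value of [C] at [(1, ..., 1)] is read off a margin, which takes a coordinate to exist. *)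
rewrite cvol0// -[RHS](copula_margins copC (Ordinal d0)) ?lexx ?ler01//; congr C.
by apply: eq_from_tnth => i; rewrite !tnth_mktuple; case: ifP.
Qed.

Section at_point.
Variable u : T.
Hypothesis cu : cube u.

Let tmin0 : tmin ab0.1 u = ab0.1.
Proof.
by apply: eq_from_tnth => i; rewrite tnth_tmin tnth_mktuple min_l//; have /andP[] := cu i.
Qed.

Let tmin1 : tmin ab0.2 u = u.
Proof.
by apply: eq_from_tnth => i; rewrite tnth_tmin tnth_mktuple min_r//; have /andP[] := cu i.
Qed.

Let phi_lo (ab : T * T) := [forall i, tnth ab.1 i <= tnth u i].
Let phi_hi (ab : T * T) := [forall i, tnth ab.2 i <= tnth u i].

Let leaves_lo_ge n : ((C u)%:E <= mu (leaves C phi_lo (level n) ab0))%E.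
Proof.
have := @measure_leaves_ge _ _ C copC u cu phi_lo (level n) ab0 box0.
rewrite tmin0 tmin1 cvol0//; apply => ab' _ h; apply/forallP => i; exact: h.
Qed.

Let leaves_hi_le n : (mu (leaves C phi_hi (level n) ab0) <= (C u)%:E)%E.
Proof.
have := @measure_leaves_le _ _ C copC u cu phi_hi (level n) ab0 box0.
rewrite tmin0 tmin1 cvol0//; apply => ab' _ /forallP h i; exact: h.
Qed.

Lemma measurable_copula_vector_orthant : measurable (copula_vector @^-1` orthant u).
Proof.
rewrite -[X in measurable X]setTI; apply: measurable_copula_vector => //.
exact: measurable_orthant.
Qed.

Let mleaves phi n : measurable (leaves C phi (level n) ab0).
Proof. exact: measurable_leaves. Qed.

(** Within [[0, 1[], the event is the decreasing intersection of the sets where the lower corner at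
    level [n] is below [u], each of measure at least [C u]. *)
Lemma copula_vector_le_ge : ((C u)%:E <= P (copula_vector @^-1` orthant u))%E.
Proof.
rewrite (uniform01E true true); last exact: measurable_copula_vector_orthant.
have -> : copula_vector @^-1` orthant u `&` `[0, 1[ =
    \bigcap_n leaves C phi_lo (level n) ab0.
  apply/seteqP; split => x.
    move=> [xu]; rewrite /= in_itv/= => x01 n _; split; first by rewrite cvol1.
    by apply/forallP => i; apply: le_trans (xu i); exact: lo_le.
  move=> h; split; last by have [] := h 0%N I; rewrite cvol1 /= in_itv.
  by move=> i; apply: vec_le => n; have [_ /forallP] := h n I.
have cvgP : mu (leaves C phi_lo (level n) ab0) @[n --> \oo] -->
    mu (\bigcap_n leaves C phi_lo (level n) ab0).
  apply: nonincreasing_cvg_mu; last 3 first.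
  - by move=> n; exact: mleaves.
  - by apply: bigcapT_measurable => n; exact: mleaves.
  - apply/nonincreasing_seqP => n; apply/subsetPset => x [x01 /forallP xu]; split => //.
    by apply/forallP => i; apply: le_trans (xu i); exact: lo_nd.
  apply: (@le_lt_trans _ _ (mu `[0, 1[%classic)).
    apply: le_measure; rewrite ?inE//; first exact: mleaves.
    by move=> x [+ _]; rewrite cvol1 /= in_itv.
  by rewrite lebesgue_measure_itv/= lte_fin ltr01 -EFinB ltry.
apply: (cvge_to_ge cvgP).
by apply: nearW => n; exact: leaves_lo_ge.
Qed.

(* No constraint where [u i = 1]: the upper corners of the boxes always satisfy [b i <= 1],
   which makes the bound below available at the points of the upper faces of the cube. *)
Definition strict_orthant : set T :=
  [set y | forall i, tnth y i < tnth u i \/ tnth u i = 1].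

Lemma measurable_strict_orthant : measurable strict_orthant.
Proof.
have -> : strict_orthant = \big[setI/setT]_(i < d) ((@tnth d R ^~ i) @^-1`
    [set s | s < tnth u i \/ tnth u i = 1]).
  apply/seteqP; split => y /=.
    by move=> yu; rewrite -bigcap_seq => i _ /=.
  by rewrite -bigcap_seq => yu i; have := yu i (mem_index_enum i).
apply: bigsetI_measurable => i _.
rewrite -[X in measurable X]setTI; apply: measurable_tnth => //.
have [->|u1] := eqVneq (tnth u i) 1.
  by rewrite (_ : [set s | _] = setT)//; apply/seteqP; split => // s _ /=; right.
rewrite (_ : [set s | _] = `]-oo, tnth u i[%classic)//.
apply/seteqP; split => s /=; rewrite in_itv/=; last by left.
by case=> // ui; rewrite ui eqxx in u1.
Qed.

(** The upper corner at level [n] exceeds the limit point by at most [2^-n], so a strict inequality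
    survives at some level. The event is thus covered by an increasing union of sets of measure at
    most [C u]. *)
Lemma copula_vector_lt_le : (P (copula_vector @^-1` strict_orthant) <= (C u)%:E)%E.
Proof.
have mS : measurable (copula_vector @^-1` strict_orthant).
  rewrite -[X in measurable X]setTI; apply: measurable_copula_vector => //.
  exact: measurable_strict_orthant.
rewrite (uniform01E true true)//.
apply: (@le_trans _ _ (mu (\bigcup_n leaves C phi_hi (level n) ab0))).
  apply: le_measure; rewrite ?inE//; first exact: measurableI.
    by apply: bigcupT_measurable => n; exact: mleaves.
  move=> x [xu]; rewrite /= in_itv/= => x01.
  have [n xn] : exists n, forall i, tnth (hi n x) i <= tnth u i.
    have /choice[f fP] : forall i, exists n, tnth (hi n x) i <= tnth u i.
      move=> i; have [xi|->] := xu i; last first.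
        by exists 0%N; have [_ c2 _] := box_level 0 x; have /andP[] := c2 i.
      have ui : 0 < tnth u i - tnth (copula_vector x) i by rewrite subr_gt0.
      have := @cvg_expr R 2^-1; rewrite ger0_norm ?invr_ge0// invf_lt1// ltr1n => /(_ isT).
      move=> /cvgr_lt/(_ _ ui)/filter_ex[n /ltW hn]; exists n.
      by rewrite width -lerBrDl (le_trans hn)// lerB// lo_le.
    exists (\max_(i < d) f i)%N => i; apply: le_trans (fP i).
    by apply: hi_ni; exact: (leq_bigmax i).
  by exists n => //; split; [rewrite cvol1|apply/forallP].
have cvgP : mu (leaves C phi_hi (level n) ab0) @[n --> \oo] -->
    mu (\bigcup_n leaves C phi_hi (level n) ab0).
  apply: nondecreasing_cvg_mu.
  - by move=> n; exact: mleaves.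
  - by apply: bigcupT_measurable => n; exact: mleaves.
  - apply/nondecreasing_seqP => n; apply/subsetPset => x [x01 /forallP xu]; split => //.
    by apply/forallP => i; apply: le_trans (xu i); exact: hi_ni.
apply: (cvge_to_le cvgP).
by apply: nearW => n; exact: leaves_hi_le.
Qed.

End at_point.
End copula_vector.

Lemma le_measure_mod_null dT (T : measurableType dT) (R : realType)
    (m : {measure set T -> \bar R}) (I : finType) (A B : set T) (N : I -> set T) :
  measurable A -> measurable B -> (forall i, measurable (N i)) ->
  (forall i, m (N i) = 0%E) -> A `<=` [set x | B x \/ exists i, N i x] ->
  (m A <= m B)%E.
Proof.
move=> mA mB mN N0 AB; pose NN := \big[setU/set0]_(i : I) N i.
have [mNN NN0] : measurable NN /\ m NN = 0%E.
  apply: (big_ind (fun X : set T => measurable X /\ m X = 0%E)) => //.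
    by move=> X Y [mX X0] [mY Y0]; split; [exact: measurableU|rewrite measureU0].
rewrite -(measureU0 mB mNN NN0); apply: le_measure; rewrite ?inE//.
  exact: measurableU.
move=> x /AB[Bx|[i Nix]]; [by left|right].
by rewrite /NN -bigcup_seq; exists i => //=; rewrite mem_index_enum.
Qed.

Lemma uniform01_itv (R : realType) (t : R) : 0 <= t <= 1 ->
  uniform_prob (@ltr01 R) `]-oo, t]%classic = t%:E.
Proof.
move=> /andP[t0 t1]; rewrite (uniform01E false false)//.
have -> : `]-oo, t] `&` `]0, 1] = `]0, t]%classic.
  apply/seteqP; split => x /=; rewrite !in_itv/=; first by move=> [-> /andP[->]].
  by move=> /andP[-> xt]; rewrite xt (le_trans xt).
rewrite lebesgue_measure_itv/= lte_fin -EFinB subr0.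
by move: t0; rewrite le_eqVlt => /predU1P[<-|->]; rewrite ?ltxx.
Qed.

Lemma uniform01_null (R : realType) (A : set R) : measurable A ->
  lebesgue_measure (A `&` `]0, 1[) = 0%E -> uniform_prob (@ltr01 R) A = 0%E.
Proof. by move=> mA A0; rewrite (uniform01E false true). Qed.

Lemma uniform01_set1 (R : realType) (t : R) : uniform_prob (@ltr01 R) [set t] = 0%E.
Proof.
apply: uniform01_null => //.
apply/eqP; rewrite -measure_le0 -(lebesgue_measure_set1 t).
by apply: le_measure; rewrite ?inE//; exact: measurableI.
Qed.

Section copula_vector_law.
Variables (R : realType) (d : nat) (C : d.-tuple R -> R).
Hypotheses (d0 : (0 < d)%N) (copC : is_copula C).
Local Notation P := (uniform_prob (@ltr01 R)).
Local Notation U := (copula_vector C).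

Let point (i : 'I_d) (t : R) : d.-tuple R := [tuple if j == i then t else 1 | j < d].

Let cube_point i t : 0 <= t <= 1 -> cube (point i t).
Proof. by move=> t01 j; rewrite tnth_mktuple; case: ifP; rewrite ?lexx ?ler01. Qed.

Let tnthU i (A : set R) := (fun x => tnth (U x) i) @^-1` A.

Let measurable_tnthU i A : measurable A -> measurable (tnthU i A).
Proof.
move=> mA; rewrite -[X in measurable X]setTI.
exact: (measurableT_comp (measurable_tnth i) (measurable_copula_vector C)).
Qed.

(** The lower bound is used at [t]; the upper one at a point slightly above [t], whose strict
    orthant contains [{U_i <= t}]. *)
Let tnthU_itv i t : 0 <= t <= 1 -> P (tnthU i `]-oo, t]) = t%:E.
Proof.
move=> t01; apply/eqP; rewrite eq_le; apply/andP; split; last first.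
  rewrite -[leLHS](congr1 EFin (copula_margins copC i t01)).
  apply: (le_trans (copula_vector_le_ge d0 copC (cube_point i t01))).
  apply: le_measure; rewrite ?inE//; first exact: measurable_copula_vector_orthant.
    exact: measurable_tnthU.
  by move=> x /(_ i); rewrite [leRHS]tnth_mktuple eqxx /tnthU/= in_itv.
(* Capping at [1] keeps the point in the cube; if the cap is active, [strict_orthant] leaves
   coordinate [i] free. *)
apply/lee_addgt0Pr => e e0; pose s := Num.min 1 (t + e).
have [t0 t1] := andP t01.
have s01 : 0 <= s <= 1 by rewrite le_min ler01 ge_min lexx addr_ge0// ltW.
apply: (@le_trans _ _ s%:E); last by rewrite lee_fin ge_min lexx orbT.
rewrite -[leRHS](congr1 EFin (copula_margins copC i s01)).
apply: le_trans (copula_vector_lt_le d0 copC (cube_point i s01)).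
apply: le_measure; rewrite ?inE//; first exact: measurable_tnthU.
  rewrite -[X in measurable X]setTI; apply: measurable_copula_vector => //.
  exact: measurable_strict_orthant.
move=> x; rewrite /tnthU/= in_itv/= => xt j; rewrite [tnth (point _ _) _]tnth_mktuple.
case: eqP => [->|_]; last by right.
have [t1e|t1e] := leP 1 (t + e); first by right; rewrite /s min_l.
by left; rewrite /s min_r ?ltW// (le_lt_trans xt)// ltrDl.
Qed.

Lemma copula_vector_margin i (A : set R) : measurable A -> P (tnthU i A) = P A.
Proof.
have mX : @measurable_fun _ _ (measurableTypeR R) R setT (fun x => tnth (U x) i).
  exact: (measurableT_comp (measurable_tnth i) (measurable_copula_vector C)).
pose X := @mfun_Sub _ _ (measurableTypeR R) R _ (mem_set mX).
suff XP t : P (tnthU i `]-oo, t]) = P `]-oo, t]%classic.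
  exact: (@probability_real_unique R (distribution P X) P XP A).
have [t0|t0] := ltP t 0.
  rewrite (_ : tnthU i _ = set0) ?measure0; last first.
    apply/seteqP; split => // x; rewrite /tnthU/= in_itv/= => xt.
    by have /andP[+ _] := copula_vector_cube C x i; rewrite leNgt (le_lt_trans xt).
  apply/esym/uniform01_null => //; rewrite (_ : _ `&` _ = set0) ?measure0//.
  apply/seteqP; split => // x [] /=; rewrite !in_itv/= => xt /andP[x0 _].
  by have := lt_trans (le_lt_trans xt t0) x0; rewrite ltxx.
have [t1|t1] := leP t 1; first by rewrite uniform01_itv ?tnthU_itv ?t0.
have E1 (m : R -> R) : (forall x, 0 <= m x <= 1) -> m @^-1` `]-oo, t] = m @^-1` `]-oo, 1].
  move=> m01; apply/seteqP; split => x /=; rewrite !in_itv/=.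
    by have /andP[] := m01 x.
  by move=> m1; rewrite (le_trans m1)// ltW.
rewrite [LHS](_ : _ = 1%E).
  apply/esym/eqP; rewrite eq_le probability_le1//= -[leLHS](@uniform01_itv R 1) ?lexx ?ler01//.
  by apply: le_measure; rewrite ?inE//; apply: subset_itvl; rewrite bnd_simp ltW.
have -> : tnthU i `]-oo, t] = setT.
  apply/seteqP; split => // x _; rewrite /tnthU/= in_itv/=.
  by have /andP[_ h] := copula_vector_cube C x i; rewrite (le_trans h)// ltW.
exact: probability_setT.
Qed.

Lemma copula_vector_law (u : d.-tuple R) : cube u -> P (U @^-1` orthant u) = (C u)%:E.
Proof.
move=> cu; apply/eqP; rewrite eq_le copula_vector_le_ge// andbT.
apply: le_trans (copula_vector_lt_le d0 copC cu).
apply: (@le_measure_mod_null _ (measurableTypeR R) R P 'I_d _ _ (fun i => tnthU i [set tnth u i])).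
- exact: measurable_copula_vector_orthant.
- rewrite -[X in measurable X]setTI; apply: measurable_copula_vector => //.
  exact: measurable_strict_orthant.
- by move=> i; exact: measurable_tnthU.
- move=> i; exact: (eq_trans (copula_vector_margin i (measurable_set1 _)) (uniform01_set1 _)).
move=> x xu /=.
have [[i xi]|/forallNP xi] := pselect (exists i, tnth (U x) i = tnth u i).
  by right; exists i.
by left => i; left; rewrite lt_neqAle xu andbT; apply/eqP.
Qed.

End copula_vector_law.

(** * Transport cost and quantiles *)

Section transport_cost.
Variables (R : realType) (d : nat) (p : R).
Local Notation T := (d.-tuple R).

Definition transport_cost (r : R) (pi : probability (T * T)%type R) : \bar R :=
  (\int[pi]_z (lnorm r (subt z.1 z.2) `^ p)%:E)%E.

Lemma measurable_tnth1 i : measurable_fun setT (fun z : T * T => tnth z.1 i).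
Proof. exact: (measurableT_comp (measurable_tnth i)). Qed.

Lemma measurable_tnth2 i : measurable_fun setT (fun z : T * T => tnth z.2 i).
Proof. exact: (measurableT_comp (measurable_tnth i)). Qed.

Lemma measurable_diff_powR dS (S : measurableType dS) (r : R) (f g : S -> R) :
  measurable_fun setT f -> measurable_fun setT g ->
  measurable_fun setT (fun z => `|f z - g z| `^ r).
Proof.
move=> mf mg; apply: (measurableT_comp (measurable_powR _)).
by apply: measurableT_comp => //; exact: measurable_funB.
Qed.

Lemma measurable_cost (r : R) :
  measurable_fun setT (fun z : T * T => (lnorm r (subt z.1 z.2) `^ p)%:E).
Proof.
apply/measurable_EFinP; apply: (measurableT_comp (measurable_powR _)).
apply: (measurableT_comp (measurable_powR _)); apply: measurable_sum => i.
under eq_fun do rewrite tnth_mktuple.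
apply: measurable_diff_powR; [exact: measurable_tnth1|exact: measurable_tnth2].
Qed.

Lemma transport_cost_le (c1 c2 r s : R) pi : 0 <= c1 -> 0 <= c2 ->
  (forall x : T, c1 * lnorm r x `^ p <= c2 * lnorm s x `^ p) ->
  (c1%:E * transport_cost r pi <= c2%:E * transport_cost s pi)%E.
Proof.
move=> c10 c20 le_rs.
have costZ c t : 0 <= c -> (c%:E * transport_cost t pi =
    \int[pi]_z (c%:E * (lnorm t (subt z.1 z.2) `^ p)%:E))%E.
  move=> c0; rewrite ge0_integralZl//; first exact: measurable_cost.
  by move=> z _; rewrite lee_fin powR_ge0.
rewrite (costZ _ _ c10) (costZ _ _ c20).
apply: ge0_le_integral.
- exact: measurableT.
- by move=> z _; rewrite mule_ge0// lee_fin powR_ge0.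
- by apply: measurable_funeM; exact: measurable_cost.
- by apply: measurable_funeM; exact: measurable_cost.
- by move=> z _; rewrite -!EFinM lee_fin; exact: le_rs.
Qed.

Lemma transport_cost_sum pi : 0 < p -> transport_cost p pi =
  (\sum_(i < d) \int[pi]_z (`|tnth z.1 i - tnth z.2 i| `^ p)%:E)%E.
Proof.
move=> p0; rewrite -ge0_integral_sum//.
- apply: eq_integral => z _; rewrite lnorm_powR// -sumEFin.
  by apply: eq_bigr => i _; rewrite tnth_mktuple.
- move=> i; apply/measurable_EFinP.
  apply: measurable_diff_powR; [exact: measurable_tnth1|exact: measurable_tnth2].
Qed.

Lemma wasserstein_powR (q : R) (mu nu : probability T R) : 0 < p ->
  (wasserstein p q mu nu `^ p)%E =
  ereal_inf [set transport_cost q pi | pi in coupling mu nu].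
Proof.
move=> p0; rewrite /wasserstein -poweRrM mulVf ?gt_eqF// poweRe1//.
apply: le_ereal_inf_tmp => _ [pi _ <-]; apply: integral_ge0 => z _.
by rewrite lee_fin powR_ge0.
Qed.

End transport_cost.

Section quantile_cost.
Variables (R : realType) (d : nat) (p : R).
Hypothesis p1 : 1 <= p.
Local Notation T := (d.-tuple R).
Local Notation P := (uniform_prob (@ltr01 R)).
Variables mu nu : probability T R.

Let p0 : 0 < p. Proof. exact: lt_le_trans p1. Qed.

Let Q (m : probability T R) i := quantile01 (marginal_cdf m i).

Let mQ m i : measurable_fun setT (Q m i).
Proof. exact: measurable_quantile01. Qed.

Definition quantile_cost : \bar R :=
  (\int[lebesgue_measure]_(u in `[0%R, 1%R])
     (lnorm p (subt (quantile_vec mu u) (quantile_vec nu u)) `^ p)%:E)%E.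

Lemma quantile_cost_sum :
  quantile_cost = (\sum_(i < d) \int[P]_u (`|Q mu i u - Q nu i u| `^ p)%:E)%E.
Proof.
rewrite -ge0_integral_sum//; last first.
  by move=> i; apply/measurable_EFinP; apply: measurable_diff_powR; exact: mQ.
have mS : measurable_fun setT (fun u => \sum_(i < d) (`|Q mu i u - Q nu i u| `^ p)%:E)%E.
  by apply: emeasurable_sum => i; apply/measurable_EFinP; apply: measurable_diff_powR; exact: mQ.
have QE u : u \in (`]0, 1[%classic : set R) -> (\sum_(i < d) (`|Q mu i u - Q nu i u| `^ p)%:E)%E =
    (lnorm p (subt (quantile_vec mu u) (quantile_vec nu u)) `^ p)%:E.
  rewrite inE/= in_itv/= => u01; rewrite lnorm_powR// -sumEFin; apply: eq_bigr => i _.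
  by rewrite !tnth_mktuple /Q /quantile01 u01.
rewrite integral_uniform01//; last by move=> u; rewrite sume_ge0// => i _; rewrite lee_fin powR_ge0.
rewrite /quantile_cost integral_itv_bndoo; last first.
  by apply: (eq_measurable_fun _ QE); exact: measurable_funTS.
by apply: eq_integral => u /QE.
Qed.

(** The one-dimensional optimality is applied to each pair of [i]-th coordinates under [pi], whose
    distribution functions are the margins of [mu] and [nu]. *)
Lemma quantile_cost_le pi : coupling mu nu pi -> (quantile_cost <= transport_cost p p pi)%E.
Proof.
move=> cpi; rewrite quantile_cost_sum transport_cost_sum//; apply: lee_sum => i _.
pose X := mfun_Sub (mem_set (@measurable_tnth1 R d i)).
pose Y := mfun_Sub (mem_set (@measurable_tnth2 R d i)).
have XE : (fun x => fine (cdf (X : {RV pi >-> R}) x)) = marginal_cdf mu i.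
  apply/funext => x; congr fine; rewrite /cdf /distribution /pushforward.
  have mA : measurable ((@tnth d R ^~ i) @^-1` `]-oo, x]).
    by rewrite -[X in measurable X]setTI; exact: measurable_tnth.
  have [<- _] := cpi _ mA; congr (pi _).
  by apply/seteqP; split => z //= -[].
have YE : (fun x => fine (cdf (Y : {RV pi >-> R}) x)) = marginal_cdf nu i.
  apply/funext => x; congr fine; rewrite /cdf /distribution /pushforward.
  have mA : measurable ((@tnth d R ^~ i) @^-1` `]-oo, x]).
    by rewrite -[X in measurable X]setTI; exact: measurable_tnth.
  have [_ <-] := cpi _ mA; congr (pi _).
  by apply/seteqP; split => z //= -[].
by have := comonotone_optimal (P := pi) X Y p1; rewrite XE YE.
Qed.

Section coupling_of_copula.
Variable C : T -> R.
Hypotheses (d0 : (0 < d)%N) (copC : is_copula C).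
Hypothesis muC : forall x, joint_cdf mu x = C [tuple marginal_cdf mu i (tnth x i) | i < d].
Hypothesis nuC : forall x, joint_cdf nu x = C [tuple marginal_cdf nu i (tnth x i) | i < d].

Let V (m : probability T R) (u : measurableTypeR R) : T :=
  [tuple Q m i (tnth (copula_vector C u) i) | i < d].

Let mtnthU i : measurable_fun setT (fun u : measurableTypeR R => tnth (copula_vector C u) i).
Proof. exact: (measurableT_comp (measurable_tnth i) (measurable_copula_vector C)). Qed.

Let mV m : @measurable_fun _ _ (measurableTypeR R) T setT (V m).
Proof.
apply/measurable_fun_tnthP => i.
rewrite (_ : _ \o _ = Q m i \o (fun u => tnth (copula_vector C u) i)).
  exact: (measurableT_comp (mQ m i) (mtnthU i)).
by apply/funext => u /=; rewrite tnth_mktuple.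
Qed.

(** When all [U_i] lie in []0, 1[], which is almost sure, [V <= x] means [U_i <= F_i(x_i)] for all
    [i]; this has probability [C(F_1(x_1), ..., F_d(x_d))], the joint distribution function at
    [x]. *)
Let V_law m : (forall x, joint_cdf m x = C [tuple marginal_cdf m i (tnth x i) | i < d]) ->
  forall A, measurable A -> P (V m @^-1` A) = m A.
Proof.
move=> mC A mA; pose X := @mfun_Sub _ _ (measurableTypeR R) T _ (mem_set (mV m)).
suff XP x : P (V m @^-1` orthant x) = m (orthant x).
  exact: (@probability_tuple_unique R d (distribution P X) m XP A mA).
pose y : T := [tuple marginal_cdf m i (tnth x i) | i < d].
have cy : cube y.
  by move=> i; rewrite tnth_mktuple fine_cdf_ge0 fine_cdf_le1.
have <- : P (copula_vector C @^-1` orthant y) = m (orthant x).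
  rewrite copula_vector_law// -mC /joint_cdf -/(orthant x) fineK// fin_num_measure//.
  exact: measurable_orthant.
pose N (i : 'I_d) := (fun u => tnth (copula_vector C u) i) @^-1` (~` `]0, 1[%classic).
have mO : measurable (~` (`]0, 1[%classic : set R)) by exact: measurableC.
have mN i : measurable (N i).
  by rewrite -[X in measurable X]setTI; exact: mtnthU.
have N0 i : P (N i) = 0%E.
  rewrite (copula_vector_margin d0 copC i mO); apply: uniform01_null => //.
  by rewrite setICl measure0.
have mVx : measurable (V m @^-1` orthant x).
  by rewrite -[X in measurable X]setTI; apply: mV => //; exact: measurable_orthant.
have mUy : measurable (copula_vector C @^-1` orthant y).
  exact: measurable_copula_vector_orthant.
have VU u : (forall i, ~ N i u) -> (V m @^-1` orthant x) u <-> (copula_vector C @^-1` orthant y) u.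
  move=> Nu; have Qle i : (tnth (V m u) i <= tnth x i) = (tnth (copula_vector C u) i <= tnth y i).
    rewrite [tnth (V m u) i]tnth_mktuple [tnth y i]tnth_mktuple.
    by apply: quantile01_le; have /contrapT := Nu i; rewrite /= in_itv.
  by split => h i; have := h i; rewrite Qle.
have Ncase u : (forall i, ~ N i u) \/ exists i, N i u.
  by have [|/forallNP] := pselect (exists i, N i u); [right|left].
apply/eqP; rewrite eq_le; apply/andP; split;
  apply: (@le_measure_mod_null _ (measurableTypeR R) R P 'I_d _ _ N) => // u /= hu;
  have [/VU e|] := Ncase u; [left|right|left|right] => //.
  exact: e.1 hu.
exact: e.2 hu.
Qed.

(** The same [U] drives both components. In coordinate [i] the cost is a function of [U_i] alone, so
    its integral is the one over a uniform variable. *)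
Lemma copula_coupling : exists2 pi, coupling mu nu pi & transport_cost p p pi = quantile_cost.
Proof.
have mW : @measurable_fun _ _ (measurableTypeR R) (T * T)%type setT (fun u => (V mu u, V nu u)).
  by apply: measurable_fun_pair; exact: mV.
pose W := @mfun_Sub _ _ (measurableTypeR R) (T * T)%type _ (mem_set mW).
exists (distribution P W).
  move=> A mA; rewrite -(V_law muC mA) -(V_law nuC mA).
  by split; rewrite /distribution /pushforward; congr (P _); apply/seteqP; split => u //= -[].
rewrite transport_cost_sum// quantile_cost_sum; apply: eq_bigr => i _.
pose h u := (`|Q mu i u - Q nu i u| `^ p)%:E.
have mh : measurable_fun setT h.
  by apply/measurable_EFinP; apply: measurable_diff_powR; exact: mQ.
pose c (z : T * T) := (`|tnth z.1 i - tnth z.2 i| `^ p)%:E.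
have mc : measurable_fun setT c.
  apply/measurable_EFinP.
  apply: measurable_diff_powR; [exact: measurable_tnth1|exact: measurable_tnth2].
have c0 z : (0 <= c z)%E by rewrite lee_fin powR_ge0.
apply: (eq_trans (ge0_integral_distribution W mc c0)).
transitivity (\int[P]_u h (tnth (copula_vector C u) i))%E.
  by apply: eq_integral => u _; rewrite /h /c /= !tnth_mktuple.
pose Z := @mfun_Sub _ _ (measurableTypeR R) R _ (mem_set (mtnthU i)).
transitivity (\int[distribution P Z]_u h u)%E.
  by apply/esym; apply: (ge0_integral_distribution Z mh) => u; rewrite lee_fin powR_ge0.
(* The identity only transports the uniform law between the two displays of the Borel structure on
   the line. *)
have mid : @measurable_fun _ _ (measurableTypeR R) R setT idfun.
  by move=> _ Y mY; rewrite setTI.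
pose J := @mfun_Sub _ _ (measurableTypeR R) R _ (mem_set mid).
have h0 u : (0 <= h u)%E by rewrite lee_fin powR_ge0.
apply: (eq_trans _ (ge0_integral_distribution J mh h0)).
apply: eq_measure_integral => A mA _.
exact: (copula_vector_margin d0 copC i mA).
Qed.

End coupling_of_copula.

End quantile_cost.

(** * From the [l^p] cost to the Wasserstein distance *)

Section norm_comparison.
Variables (R : realType) (d : nat) (p q : R).
Hypotheses (p0 : 0 < p) (q0 : 0 < q).
Variables mu nu : probability (d.-tuple R) R.

(** Serves both lower bounds, with [c = 1] for [q <= p] and [c = d^(p/q - 1)] for [p <= q]. *)
Lemma le_wasserstein_powR (c : R) (x : \bar R) : 0 <= c ->
  (forall y : d.-tuple R, c * lnorm p y `^ p <= lnorm q y `^ p) ->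
  (forall pi, coupling mu nu pi -> x <= transport_cost p p pi)%E ->
  (c%:E * x <= wasserstein p q mu nu `^ p)%E.
Proof.
move=> c0 cpq xle; rewrite (wasserstein_powR _ _ _ p0).
apply: le_ereal_inf_tmp => _ [pi cpi <-].
apply: (@le_trans _ _ (c%:E * transport_cost p p pi)%E).
  by apply: lee_wpmul2l; [rewrite lee_fin|exact: xle].
rewrite -[leRHS]mul1e; apply: (@transport_cost_le R d p c 1 p q pi c0 ler01) => y.
by rewrite [leRHS]mul1r; exact: cpq.
Qed.

Lemma wasserstein_powR_le (c : R) (x : \bar R) : 0 <= c ->
  (forall y : d.-tuple R, lnorm q y `^ p <= c * lnorm p y `^ p) ->
  (exists2 pi, coupling mu nu pi & transport_cost p p pi = x) ->
  (wasserstein p q mu nu `^ p <= c%:E * x)%E.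
Proof.
move=> c0 cqp [pi cpi <-]; rewrite (wasserstein_powR _ _ _ p0).
apply: (@le_trans _ _ (transport_cost p q pi)).
  by apply: ereal_inf_lbound; exists pi.
rewrite -[leLHS]mul1e; apply: (@transport_cost_le R d p 1 c q p pi ler01 c0) => y.
by rewrite [leLHS]mul1r; exact: cqp.
Qed.

(** This is [lnorm_powR_le] from [p] to [q] raised to the power [p / q]: the constant becomes
    [d^(1 - p/q)] and moves to the other side as its inverse. *)
Lemma lnorm_powR_le_exp (y : d.-tuple R) : (0 < d)%N -> p <= q ->
  d%:R `^ (p / q - 1) * lnorm p y `^ p <= lnorm q y `^ p.
Proof.
move=> d0 pq; have dR : 0 < d%:R :> R by rewrite ltr0n.
have pq0 : 0 <= p / q by rewrite divr_ge0// ltW.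
have D0 : 0 <= d%:R `^ (q / p - 1) by exact: powR_ge0.
move: (lnorm p y) (lnorm q y) (lnorm_powR_le y d0 p0 pq) => A B AB.
have powE (r : R) : (r `^ q) `^ (p / q) = r `^ p.
  by rewrite -powRrM mulrC divfK// gt_eqF.
have := ge0_ler_powR pq0 (powR_ge0 _ _) (mulr_ge0 D0 (powR_ge0 _ _)) AB.
rewrite (powRM _ D0 (powR_ge0 _ _)) !powE -powRrM.
have -> : (q / p - 1) * (p / q) = 1 - p / q by field; rewrite !gt_eqF.
move=> /(ler_wpM2l (powR_ge0 d%:R (p / q - 1))); move/le_trans; apply.
rewrite mulrA -powRD; last by rewrite (gt_eqF dR) implybT.
by rewrite addrA subrK subrr powRr0 mul1r.
Qed.

End norm_comparison.

Local Open Scope ereal_scope.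

Theorem corollary3p11 (R : realType) (d : nat) (p q : R)
    (mu nu : probability (d.-tuple R) R)
    (hd : (0 < d)%N) (hp : (1 <= p)%R) (hq : (1 <= q)%R) (hqp : q <> p)
    (hmu : finite_moment p mu) (hnu : finite_moment p nu)
    (hC : share_copula mu nu) :
  ((q <= p)%R ->
     \int[lebesgue_measure]_(u in `[0%R, 1%R])
        (lnorm p (subt (quantile_vec mu u) (quantile_vec nu u)) `^ p)%:E
       <= wasserstein p q mu nu `^ p /\
     wasserstein p q mu nu `^ p <=
       (d%:R `^ (p / q - 1))%:E *
       \int[lebesgue_measure]_(u in `[0%R, 1%R])
        (lnorm p (subt (quantile_vec mu u) (quantile_vec nu u)) `^ p)%:E) /\
  ((p <= q)%R ->
     (d%:R `^ (p / q - 1))%:E *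
       \int[lebesgue_measure]_(u in `[0%R, 1%R])
        (lnorm p (subt (quantile_vec mu u) (quantile_vec nu u)) `^ p)%:E
       <= wasserstein p q mu nu `^ p /\
     wasserstein p q mu nu `^ p <=
       \int[lebesgue_measure]_(u in `[0%R, 1%R])
        (lnorm p (subt (quantile_vec mu u) (quantile_vec nu u)) `^ p)%:E).
Proof.
rewrite -/(quantile_cost p mu nu).
have p0 : (0 < p)%R by exact: lt_le_trans hp.
have q0 : (0 < q)%R by exact: lt_le_trans hq.
have [C [copC HC]] := hC.
have [pi cpi cost_pi] : exists2 pi, coupling mu nu pi &
    transport_cost p p pi = quantile_cost p mu nu.
  by apply: (copula_coupling hp hd copC) => x; have [] := HC x x.
have lower pi' : coupling mu nu pi' -> quantile_cost p mu nu <= transport_cost p p pi'.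
  exact: quantile_cost_le.
have upper : exists2 pi, coupling mu nu pi &
    transport_cost p p pi = quantile_cost p mu nu by exists pi.
split=> [qp|pq]; split.
- rewrite -[leLHS]mul1e; apply: (le_wasserstein_powR p0 ler01 _ lower) => y.
  by rewrite [leLHS]mul1r; exact: (lnorm_powR_ge y q0 qp).
- apply: (wasserstein_powR_le p0 (powR_ge0 _ _) _ upper) => y.
  exact: (lnorm_powR_le y hd q0 qp).
- apply: (le_wasserstein_powR p0 (powR_ge0 _ _) _ lower) => y.
  exact: (lnorm_powR_le_exp p0 q0 y hd pq).
- rewrite -[leRHS]mul1e; apply: (wasserstein_powR_le p0 ler01 _ upper) => y.
  rewrite [leRHS]mul1r.
  exact: (ge0_ler_powR (ltW p0) (powR_ge0 _ _) (powR_ge0 _ _) (lnorm_le y p0 pq)).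
Qed.
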